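(* Let $d\in\mathbb{N}$, $1\le p<q<\infty$. There exists a constant $C$ depending only on $p$, $q$ and $d$ such that the following holds. Let $\nu$ be an absolutely continuous probability distribution on $\mathbb{R}$, and let $\mu$ be a probability distribution on $\mathbb{R}^d$ with finite absolute $q$-moment $M_q(\mu)<\infty$. Then, for all integers $W\ge 7d+1$ and $L\ge 2$, $$ \mathcal{W}_p(\mu,\mathcal{NN}(W,L)_\# \nu) \le C\,(M_q^q(\mu)+1)^{1/p}\cdot \begin{cases} (W^2L)^{-1/d}, & \text{if } q>p+p/d,\\ (W^2L)^{-1/d}\,(\log_2 (W^2L))^{1/d}, & \text{if } p<q\le p+p/d. \end{cases} $$
   Context: $|\cdot|$ is the Euclidean norm. For a probability measure $\mu$ on $\mathbb{R}^d$, $M_q(\mu):=\left(\int_{\mathbb{R}^d}|x|^q\,d\mu(x)\right)^{1/q}$ and $M_q^q(\mu)=(M_q(\mu))^q$. ''Absolutely continuous'' means absolutely continuous with respect to Lebesgue measure. Neural networks: let $\sigma(x)=\max\{x,0\}$, applied element-wise. A ReLU neural network with $L$ hidden layers is a map $\phi:\mathbb{R}^{N_0}\to\mathbb{R}^{N_{L+1}}$ of the form $\phi = A_L\circ\sigma\circ A_{L-1}\circ\cdots\circ\sigma\circ A_0$, where $A_\ell(y)=M_\ell y+b_\ell$ is affine with $M_\ell\in\mathbb{R}^{N_{\ell+1}\times N_\ell}$, $b_\ell\in\mathbb{R}^{N_{\ell+1}}$. Its width is $\max_{1\le \ell\le L}N_\ell$ and its depth is $L$. Here $\mathcal{NN}(W,L)$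 denotes the set of functions $\mathbb{R}\to\mathbb{R}^d$ representable by ReLU networks of width at most $W$ and depth at most $L$. The push-forward is $\phi_\#\nu(A)=\nu(\phi^{-1}(A))$. The Wasserstein distance is $\mathcal{W}_p(\mu,\gamma)=\inf_{\xi}\left(\int|x-y|^p\,d\xi(x,y)\right)^{1/p}$, the infimum being over all couplings $\xi$ of $\mu$ and $\gamma$. We write $\mathcal{W}_p(\mu,\mathcal{NN}(W,L)_\#\nu):=\inf_{\phi\in\mathcal{NN}(W,L)}\mathcal{W}_p(\mu,\phi_\#\nu)$. *)

(* Defs.v *)
From HB Require Import structures.
From mathcomp Require Import all_boot all_order all_algebra.
From mathcomp Require Import all_classical all_reals all_analysis.
From mathcomp Require Import measurable_realfun.
Set Implicit Arguments.
Unset Strict Implicit.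
Unset Printing Implicit Defensive.
Import Order.TTheory GRing.Theory Num.Theory.
Import numFieldNormedType.Exports.
Local Open Scope classical_set_scope.
Local Open Scope ring_scope.
Local Open Scope ereal_scope.

(* R^d is the type of d-tuples: it carries the product of the Borel
   sigma-algebras of R, that is, the Borel sigma-algebra of R^d. *)
Notation euclid R d := (d.-tuple (measurableTypeR R)).

Definition enorm (R : realType) (d : nat) (x : euclid R d) : R :=
  Num.sqrt (\sum_(i < d) (tnth x i : R) ^+ 2)%R.

Definition esub (R : realType) (d : nat) (x y : euclid R d) : euclid R d :=
  [tuple ((tnth x i : R) - (tnth y i : R))%R | i < d].

Definition moment (R : realType) (d : nat) (q : R)
    (mu : probability (euclid R d) R) : \bar R :=
  (\int[mu]_x ((enorm x `^ q)%R)%:E) `^ (q^-1)%R.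

Definition coupling (R : realType) (d : nat)
    (mu gam : probability (euclid R d) R) :
    set (probability (euclid R d * euclid R d)%type R) :=
  [set xi | forall A, measurable A ->
     xi (A `*` setT) = mu A /\ xi (setT `*` A) = gam A].

Definition wasserstein (R : realType) (d : nat) (p : R)
    (mu gam : probability (euclid R d) R) : \bar R :=
  ereal_inf [set (\int[xi]_z ((enorm (esub z.1 z.2) `^ p)%R)%:E) `^ (p^-1)%R
            | xi in coupling mu gam].

Definition relu (R : realType) (x : R) : R := Num.max x 0%R.

(* [relu_net R n m] describes A_L o sigma o ... o sigma o A_0 : R^n -> R^m by
   its affine maps: [Hidden] prepends A_0 and the activation that follows it. *)
Inductive relu_net (R : realType) : nat -> nat -> Type :=
| Output n m of 'M[R]_(m, n) & 'cV[R]_m : relu_net R n m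
| Hidden n k m of 'M[R]_(k, n) & 'cV[R]_k & relu_net R k m : relu_net R n m.

Fixpoint net_eval (R : realType) (n m : nat) (f : relu_net R n m) :
    'cV[R]_n -> 'cV[R]_m :=
  match f with
  | Output _ _ M b => fun x => (M *m x + b)%R
  | Hidden _ _ _ M b g => fun x => net_eval g (map_mx (@relu R) (M *m x + b)%R)
  end.

Fixpoint net_depth (R : realType) (n m : nat) (f : relu_net R n m) : nat :=
  match f with
  | Output _ _ _ _ => 0
  | Hidden _ _ _ _ _ g => (net_depth g).+1
  end.

(* Only the hidden layers count. *)
Fixpoint net_width (R : realType) (n m : nat) (f : relu_net R n m) : nat :=
  match f with
  | Output _ _ _ _ => 0
  | Hidden _ k _ _ _ g => maxn k (net_width g)
  end.

Definition net_fun (R : realType) (d : nat) (f : relu_net R 1 d) :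
    measurableTypeR R -> euclid R d :=
  fun t => [tuple net_eval f (const_mx (t : R)) i ord0 | i < d].

(* The type [{mfun _ >-> _}] makes the push-forward a probability; by
   [measurable_net_fun] below, it excludes no network. *)
Definition NN (R : realType) (d W L : nat) :
    set {mfun measurableTypeR R >-> euclid R d} :=
  [set phi | exists f : relu_net R 1 d,
     [/\ (net_width f <= W)%N, (net_depth f <= L)%N &
         (phi : measurableTypeR R -> euclid R d) = net_fun f]].
Arguments NN : clear implicits.

Definition wasserstein_NN (R : realType) (d : nat) (p : R)
    (mu : probability (euclid R d) R) (W L : nat)
    (nu : probability (measurableTypeR R) R) : \bar R :=
  ereal_inf [set wasserstein p mu (distribution nu phi) | phi in NN R d W L].

Definition log2 (R : realType) (x : R) : R := (ln x / ln 2)%R.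

Definition rate (R : realType) (d : nat) (p q : R) (W L : nat) : R :=
  let N : R := (W ^ 2 * L)%:R in
  (if p + p / d%:R < q then N `^ (- d%:R^-1)
   else N `^ (- d%:R^-1) * log2 N `^ (d%:R^-1))%R.

Lemma measurable_net_eval (R : realType) (n m : nat) (f : relu_net R n m)
    (u : measurableTypeR R -> 'cV[R]_n) :
  (forall i, measurable_fun [set: measurableTypeR R] (fun t => u t i ord0)) ->
  forall j, measurable_fun [set: measurableTypeR R]
    (fun t => net_eval f (u t) j ord0).
Proof.
have aff n' m' (M : 'M[R]_(m', n')) (b : 'cV[R]_m')
    (v : measurableTypeR R -> 'cV[R]_n') :
  (forall i, measurable_fun [set: measurableTypeR R] (fun t => v t i ord0)) ->
  forall j, measurable_fun [set: measurableTypeR R]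
    (fun t => (M *m v t + b)%R j ord0).
  move=> mv j; under eq_fun do rewrite !mxE.
  apply: measurable_funD; last exact: measurable_cst.
  by apply: measurable_sum => i; apply: measurable_funM.
elim: f u => [n' m' M b|n' k m' M b g IH] u mu /=; first exact: aff.
apply: IH => i; under eq_fun do rewrite mxE /relu.
by apply: measurable_maxr => //; exact: aff.
Qed.

Lemma measurable_net_fun (R : realType) (d : nat) (f : relu_net R 1 d) :
  measurable_fun [set: measurableTypeR R] (net_fun f).
Proof.
apply/measurable_fun_tnthP => i; rewrite /comp /net_fun.
under eq_fun do rewrite tnth_mktuple.
apply: measurable_net_eval => k; under eq_fun do rewrite mxE.
exact: measurable_id.
Qed.

(* Main.v *)
(** All q > p give the rate (W^2 L)^(-1/d), the logarithm being at least 1.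
    Each coordinate is quantized to k values with error O((1 + |x|)^(q/p) / k),
    by cutting the range of the compression (1 + |x|)^(1 - q/p) into equal
    cells; raised to the power p, this error is integrable against mu. Let
    N ~ k^d be the number of cells, E_j the cells of positive mass and x_j their
    centres. As nu has no atoms, the line splits into consecutive sets J_j with
    nu(J_j) = mu(E_j), and a piecewise linear phi equal to x_j on an interval
    carrying almost all of J_j, uniformly bounded in between, makes the coupling
    sum_j mu|E_j x phi#(nu|J_j) / mu(E_j) almost as cheap as the quantization.

    To realize phi with N ~ W^2 L plateaus, two hidden layers handle W/4 blocks
    of W/(4d) plateaus each: the first layer supplies the breakpoints at the
    ends of the blocks, and a neuron of the second layer creates one ramp in
    every block at once, as the positive part of a function whose zero in each
    block can be placed freely. The L/2 such pairs of layers add their outputs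
    to accumulators carried through the network. *)
Require Import Defs.
From HB Require Import structures.
From mathcomp Require Import all_boot all_order all_algebra.
From mathcomp Require Import all_classical all_reals all_analysis.
From mathcomp Require Import measurable_realfun ring lra zify.
Set Implicit Arguments.
Unset Strict Implicit.
Unset Printing Implicit Defensive.
Import Order.TTheory GRing.Theory Num.Theory.
Import numFieldNormedType.Exports.
Local Open Scope classical_set_scope.
Local Open Scope ring_scope.

(** * Networks described neuron by neuron *)

Definition affine_form (R : realType) (I : finType) (f : (I -> R) -> R) :=
  exists (a : I -> R) (b : R), forall v, f v = \sum_i a i * v i + b.

Lemma affine_form_cst (R : realType) (I : finType) (c : R) :
  affine_form (fun _ : I -> R => c).
Proof.
by exists (fun=> 0), c => v; rewrite big1 ?add0r // => i _; rewrite mul0r.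
Qed.

Lemma affine_form_proj (R : realType) (I : finType) (i : I) :
  affine_form (fun v : I -> R => v i).
Proof.
exists (fun j => (j == i)%:R), 0 => v.
rewrite (bigD1 i) //= eqxx mul1r big1 ?addr0 // => j /negPf->.
by rewrite mul0r.
Qed.

Lemma affine_formD (R : realType) (I : finType) (f g : (I -> R) -> R) :
  affine_form f -> affine_form g -> affine_form (fun v => f v + g v).
Proof.
move=> [a [b fE]] [a' [b' gE]].
exists (fun i => a i + a' i), (b + b') => v; rewrite fE gE addrACA -big_split /=.
by congr (_ + _); apply: eq_bigr => i _; rewrite mulrDl.
Qed.

Lemma affine_formZ (R : realType) (I : finType) (c : R) (f : (I -> R) -> R) :
  affine_form f -> affine_form (fun v => c * f v).
Proof.
move=> [a [b fE]]; exists (fun i => c * a i), (c * b) => v.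
rewrite fE mulrDr mulr_sumr; congr (_ + _).
by apply: eq_bigr => i _; rewrite mulrA.
Qed.

Lemma affine_formB (R : realType) (I : finType) (f g : (I -> R) -> R) :
  affine_form f -> affine_form g -> affine_form (fun v => f v - g v).
Proof.
move=> af ag; have -> : (fun v => f v - g v) = (fun v => f v + -1 * g v).
  by apply/funext => v; rewrite mulN1r.
exact: affine_formD af (affine_formZ _ ag).
Qed.

Lemma affine_form_sum (R : realType) (I K : finType) (f : K -> (I -> R) -> R) :
  (forall k, affine_form (f k)) -> affine_form (fun v => \sum_k f k v).
Proof.
move=> af.
suff H (s : seq K) : affine_form (fun v => \sum_(k <- s) f k v) by exact: H.
elim: s => [|k s IH].
  by under eq_fun do rewrite big_nil; exact: affine_form_cst.
by under eq_fun do rewrite big_cons; exact: affine_formD.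
Qed.

Lemma affine_forms_matrix (R : realType) (I J : finType)
    (A : J -> (I -> R) -> R) : (forall j, affine_form (A j)) ->
  exists (M : 'M[R]_(#|J|, #|I|)) (b : 'cV[R]_#|J|), forall v,
    M *m (\col_i v (enum_val i)) + b = \col_j A (enum_val j) v.
Proof.
move=> /choice[a /choice[b AE]].
exists (\matrix_(j, i) a (enum_val j) (enum_val i)), (\col_j b (enum_val j)).
move=> v; apply/matrixP => j k; rewrite !mxE AE; congr (_ + _).
rewrite [RHS](reindex (@enum_val I predT)) /=; last first.
  exact/onW_bij/enum_val_bij.
by apply: eq_bigr => i _; rewrite !mxE.
Qed.

(** An affine map placed before a network merges with its first affine map, so affine glue between
    modules costs neither width nor depth. *)
Lemma net_precomp (R : realType) (n k m : nat) (f : relu_net R k m)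
    (M : 'M[R]_(k, n)) (b : 'cV[R]_k) :
  exists g : relu_net R n m, [/\ net_width g = net_width f,
    net_depth g = net_depth f &
    forall x, net_eval g x = net_eval f (M *m x + b)].
Proof.
case: f M b => [k' m' N c|k' h m' N c f] M b.
  exists (Output (N *m M) (N *m b + c)); split=> // x /=.
  by rewrite mulmxDr mulmxA addrA.
exists (Hidden (N *m M) (N *m b + c) f); split=> // x /=.
by rewrite mulmxDr mulmxA addrA.
Qed.

(* Coordinates are indexed by arbitrary finite types, so that a layer can be
   described neuron by neuron, without block matrices. *)
Definition realized (R : realType) (w m : nat) (I : finType) (l : nat)
    (F : (I -> R) -> 'cV[R]_m) :=
  exists f : relu_net R #|I| m, [/\ (net_width f <= w)%N, (net_depth f <= l)%N &
    forall v, net_eval f (\col_i v (enum_val i)) = F v].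

Lemma realized_affine (R : realType) (w m : nat) (I : finType)
    (A : 'I_m -> (I -> R) -> R) : (forall j, affine_form (A j)) ->
  realized w 0 (fun v => \col_j A j v).
Proof.
move=> /choice[a /choice[b AE]].
exists (Output (\matrix_(j, i) a j (enum_val i)) (\col_j b j)).
split=> // v /=; apply/matrixP => j k; rewrite !mxE AE; congr (_ + _).
rewrite [RHS](reindex (@enum_val I predT)) /=; last first.
  exact/onW_bij/enum_val_bij.
by apply: eq_bigr => i _; rewrite !mxE.
Qed.

Lemma realized_comp (R : realType) (w m : nat) (I J : finType) (l : nat)
    (G : (J -> R) -> 'cV[R]_m) (A : J -> (I -> R) -> R) :
  (forall j, affine_form (A j)) -> realized w l G ->
  realized w l (fun v => G (fun j => A j v)).
Proof.
move=> /affine_forms_matrix[M [b MbE]] [f [fw fl fE]].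
have [g [gw gl gE]] := net_precomp f M b.
exists g; rewrite gw gl; split=> //.
by move=> v; rewrite gE MbE (fE (fun j => A j v)).
Qed.

Lemma realized_relu (R : realType) (w m : nat) (I J : finType) (l : nat)
    (G : (J -> R) -> 'cV[R]_m) (A : J -> (I -> R) -> R) :
  (#|J| <= w)%N -> (forall j, affine_form (A j)) -> realized w l G ->
  realized w l.+1 (fun v => G (fun j => relu (A j v))).
Proof.
move=> Jw /affine_forms_matrix[M [b MbE]] [f [fw fl fE]].
exists (Hidden M b f); split=> //= [|v]; first by rewrite geq_max Jw.
rewrite MbE -(fE (fun j => relu (A j v))); congr net_eval.
by apply/matrixP => i j; rewrite !mxE.
Qed.

Lemma relu_subN (R : realType) (x : R) : relu x - relu (- x) = x.
Proof.
rewrite /relu; case: (leP 0 x) => x0.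
  by rewrite max_r ?oppr_le0// subr0.
by rewrite max_l ?oppr_ge0 ?ltW// add0r opprK.
Qed.

(** What one pair of hidden layers of width [w] contributes to the output: the first layer supplies
    breakpoints [xi] of the scalar input, the second takes positive parts of combinations of them,
    and [V] reads these out linearly. *)
Definition relu_module (R : realType) (d w : nat) (g : R -> 'I_d -> R) :=
  exists (K1 K2 : finType) (xi : K1 -> R) (c : K2 -> K1 -> R)
    (V : 'I_d -> K2 -> R), [/\ (#|K1| <= w)%N, (#|K2| <= w)%N &
    forall t l, g t l =
      \sum_s V l s * relu (\sum_k c s k * relu (t - xi k))].

(* The state holds the input [v None] and the accumulators [v (Some l)]; each
   is carried through a hidden layer by the two neurons relu(+-v), which is what
   costs the extra width 2(d+1). *)
Lemma realized_module (R : realType) (d w W m l : nat) (g : R -> 'I_d -> R)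
    (G : (option 'I_d -> R) -> 'cV[R]_m) :
  relu_module w g -> (2 * d.+1 + w <= W)%N -> realized W l G ->
  realized W l.+2 (fun v => G (fun o =>
    v o + (if o is Some i then g (v None) i else 0))).
Proof.
move=> [K1 [K2 [xi [c [V [K1w K2w gE]]]]]] wW rG.
pose sg (b : bool) : R := if b then 1 else -1.
have cardJ (K : finType) : (#|K| <= w)%N ->
    (#|{: (bool * option 'I_d) + K}| <= W)%N.
  move=> Kw; rewrite card_sum card_prod card_bool card_option card_ord.
  by apply: leq_trans wW; rewrite leq_add2l.
pose J1 : finType := ((bool * option 'I_d) + K1)%type.
pose J2 : finType := ((bool * option 'I_d) + K2)%type.
pose A3 (o : option 'I_d) (v : J2 -> R) : R :=
  (v (inl (true, o)) - v (inl (false, o))) +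
  (if o is Some i then \sum_s V i s * v (inr s) else 0).
pose A2 (j : J2) (v : J1 -> R) : R := match j with
  | inl bo => sg bo.1 * (v (inl (true, bo.2)) - v (inl (false, bo.2)))
  | inr s => \sum_k c s k * v (inr k) end.
pose A1 (j : J1) (v : option 'I_d -> R) : R := match j with
  | inl bo => sg bo.1 * v bo.2
  | inr k => v None - xi k end.
have a3 o : affine_form (A3 o).
  apply: affine_formD; first exact/affine_formB/affine_form_proj/affine_form_proj.
  case: o => [i|]; last exact: affine_form_cst.
  by apply: affine_form_sum => s; exact/affine_formZ/affine_form_proj.
have a2 j : affine_form (A2 j).
  case: j => [bo|s].
    exact/affine_formZ/affine_formB/affine_form_proj/affine_form_proj.
  by apply: affine_form_sum => k; exact/affine_formZ/affine_form_proj.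
have a1 j : affine_form (A1 j).
  case: j => [bo|k]; first exact/affine_formZ/affine_form_proj.
  exact/affine_formB/affine_form_cst/affine_form_proj.
have := realized_relu (cardJ _ K1w) a1
  (realized_relu (cardJ _ K2w) a2 (realized_comp a3 rG)).
congr realized; apply/funext => v; congr G; apply/funext => o.
rewrite /A3 /A2 /A1 /sg /= !mul1r !mulN1r !relu_subN.
by congr (_ + _); case: o => [i|//]; rewrite gE.
Qed.

(** The induction peels off the module nearest to the input; the remaining ones, shifted by one, act
    on the accumulators it has already updated. *)
Lemma realized_modules (R : realType) (d w W n : nat)
    (g : nat -> R -> 'I_d -> R) :
  (forall r, relu_module w (g r)) -> (2 * d.+1 + w <= W)%N ->
  realized W n.*2 (fun v : option 'I_d -> R =>
    \col_l (v (Some l) + \sum_(r < n) g r (v None) l)).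
Proof.
move=> + wW; elim: n g => [|n IH] g rg.
  have := @realized_affine R W d _ (fun l v => v (Some l)) (fun l => affine_form_proj _ _).
  congr realized; apply/funext => v; apply/matrixP => i j.
  by rewrite !mxE big_ord0 addr0.
have := realized_module (rg 0%N) wW (IH (g \o S) (fun r => rg r.+1)).
congr realized; apply/funext => v; apply/matrixP => i j.
by rewrite !mxE big_ord_recl/= addr0 addrA.
Qed.

Lemma sum_modules_net (R : realType) (d w W L n : nat)
    (g : nat -> R -> 'I_d -> R) :
  (forall r, relu_module w (g r)) -> (2 * d.+1 + w <= W)%N -> (n.*2 <= L)%N ->
  exists f : relu_net R 1 d, [/\ (net_width f <= W)%N, (net_depth f <= L)%N &
    forall t i, tnth (net_fun f t) i = \sum_(r < n) g r t i].
Proof.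
move=> rg wW nL; have [f [fw fl fE]] := realized_modules n rg wW.
(* The initial state, with [t] in slot [None] and zero accumulators, depends linearly on the
   input. *)
pose M : 'cV[R]_#|{: option 'I_d}| := \col_i (enum_val i == None)%:R.
have [h [hw hl hE]] := net_precomp f M 0.
exists h; rewrite hw hl; split=> // [|t i]; first exact: leq_trans nL.
rewrite tnth_mktuple hE addr0.
have -> : M *m const_mx t = \col_i (if enum_val i == None then t else 0).
  apply/matrixP => j k; rewrite !mxE big_ord1 !mxE.
  by case: eqP => _; rewrite ?mul1r ?mul0r.
by rewrite (fE (fun o => if o == None then t else 0)) mxE /= add0r.
Qed.

(** * Piecewise linear functions with prescribed plateaus *)

Lemma relu_ge0 (R : realType) (x : R) : 0 <= relu x.
Proof. by rewrite le_max lexx orbT. Qed.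

Lemma relu_id (R : realType) (x : R) : 0 <= x -> relu x = x.
Proof. exact: max_l. Qed.

Lemma relu_eq0 (R : realType) (x : R) : x <= 0 -> relu x = 0.
Proof. exact: max_r. Qed.

Lemma reluM (R : realType) (h x : R) : 0 <= h -> relu (h * x) = h * relu x.
Proof. by move=> h0; rewrite /relu -[in LHS](mulr0 h) maxr_pMr. Qed.

(* The piecewise linear function vanishing outside ]f, e'[ with values
   -(z - f') at f' and e - z at e, hence of slope 1 and with a zero at z in
   between: only its zero depends on z, its breakpoints do not. *)
Definition bump (R : realType) (f f' z e e' t : R) : R :=
  let s := (z - f') / (f' - f) in let s' := (e - z) / (e' - e) in
  - s * relu (t - f) + (1 + s) * relu (t - f')
  - (1 + s') * relu (t - e) + s' * relu (t - e').

Lemma bump_out (R : realType) (f f' z e e' t : R) :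
  f < f' -> f' <= e -> e < e' -> t <= f \/ e' <= t -> bump f f' z e e' t = 0.
Proof.
move=> ff' f'e ee' tfe; rewrite /bump.
have f'f0 : f' - f != 0 by rewrite gt_eqF// subr_gt0.
have e'e0 : e' - e != 0 by rewrite gt_eqF// subr_gt0.
case: tfe => [tf|te]; first by rewrite !relu_eq0 ?mulr0 ?addr0 ?subr0//; lra.
by rewrite !relu_id; [field; rewrite f'f0 e'e0|lra..].
Qed.

(** Since [bump] is nonpositive on [f, z], its positive part forgets [f] and [f']: it rises with
    slope 1 from [z] to [e], then descends linearly to 0 at [e']. *)
Lemma relu_bump (R : realType) (f f' z e e' t : R) :
  f < f' -> f' <= z -> z <= e -> e < e' ->
  relu (bump f f' z e e' t) =
  if t <= e then relu (t - z) else relu ((e - z) * ((e' - t) / (e' - e))).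
Proof.
move=> ff' f'z ze ee'.
have f'e := le_trans f'z ze.
have f'f0 : 0 < f' - f by rewrite subr_gt0.
have e'e0 : 0 < e' - e by rewrite subr_gt0.
have f'fN0 := lt0r_neq0 f'f0; have e'eN0 := lt0r_neq0 e'e0.
have [tf|tf] := leP t f.
  rewrite bump_out//; last by left.
  by rewrite ifT ?[LHS]relu_eq0 ?relu_eq0//; lra.
have [te|te] := leP t e; last first.
  have [te'|te'] := leP t e'; last first.
    rewrite bump_out//; last by right; lra.
    rewrite [LHS]relu_eq0// relu_eq0// mulr_ge0_le0 ?subr_ge0//.
    by rewrite ler_pdivrMr// mul0r; lra.
  rewrite /bump (relu_eq0 (_ : t - e' <= 0)) ?(relu_id (_ : 0 <= t - e))
    ?(relu_id (_ : 0 <= t - f)) ?(relu_id (_ : 0 <= t - f')); try lra.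
  by congr relu; field; rewrite f'fN0 e'eN0.
rewrite /bump (relu_eq0 (_ : t - e' <= 0)) ?(relu_eq0 (_ : t - e <= 0)); try lra.
rewrite !mulr0 addr0 subr0 (relu_id (_ : 0 <= t - f)); last lra.
have [tf'|tf'] := leP t f'; last first.
  rewrite (relu_id (_ : 0 <= t - f')); last lra.
  by congr relu; field.
rewrite (relu_eq0 (_ : t - f' <= 0)) ?mulr0 ?addr0; last lra.
rewrite !relu_eq0//; first lra.
by rewrite mulNr oppr_le0 mulr_ge0 ?divr_ge0//; lra.
Qed.

(** A trapezoid: it climbs from 0 to 1 on [l, r], stays at 1 up to [e], and returns to 0 on [e, e'].
    The ramps starting at [l] and [r] differ by exactly [r - l] on [r, e]. *)
Definition step_fun (R : realType) (f f' l r e e' t : R) : R :=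
  (relu (bump f f' l e e' t) - relu (bump f f' r e e' t)) / (r - l).

Lemma step_fun_ge0_le1 (R : realType) (f f' l r e e' t : R) :
  f < f' -> f' <= l -> l < r -> r <= e -> e < e' ->
  0 <= step_fun f f' l r e e' t <= 1.
Proof.
move=> ff' f'l lr re ee'; rewrite /step_fun !relu_bump//; try lra.
have rl : 0 < r - l by rewrite subr_gt0.
suff /andP[n0 n1] : 0 <= (if t <= e then relu (t - l) else
      relu ((e - l) * ((e' - t) / (e' - e)))) -
    (if t <= e then relu (t - r) else relu ((e - r) * ((e' - t) / (e' - e))))
    <= r - l.
  by rewrite ler_pdivrMr// mul1r n1 divr_ge0// ltW.
have [te|te] := leP t e.
  by rewrite /relu; case: (leP (t - l)); case: (leP (t - r)); lra.
have [te'|te'] := leP t e'; last first.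
  have h : (e' - t) / (e' - e) <= 0 by rewrite ler_pdivrMr ?mul0r; lra.
  by rewrite !relu_eq0; rewrite ?(mulr_ge0_le0 _ h)//; lra.
have h0 : 0 <= (e' - t) / (e' - e) by rewrite divr_ge0//; lra.
have h1 : (e' - t) / (e' - e) <= 1 by rewrite ler_pdivrMr ?mul1r; lra.
rewrite !relu_id; rewrite ?(mulr_ge0 _ h0)//; try lra.
have : 0 <= (r - l) * (1 - (e' - t) / (e' - e)) by rewrite mulr_ge0//; lra.
have : 0 <= (r - l) * ((e' - t) / (e' - e)) by rewrite mulr_ge0//; lra.
by move: (_ / _) => X; lra.
Qed.

Lemma step_fun_eq1 (R : realType) (f f' l r e e' t : R) :
  f < f' -> f' <= l -> l < r -> r <= e -> e < e' -> r <= t <= e ->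
  step_fun f f' l r e e' t = 1.
Proof.
move=> ff' f'l lr re ee' /andP[rt te]; rewrite /step_fun !relu_bump//; try lra.
rewrite te !relu_id; try lra.
by rewrite opprB addrC addrA subrK divff// subr_eq0 gt_eqF.
Qed.

Lemma step_fun_eq0 (R : realType) (f f' l r e e' t : R) :
  f < f' -> f' <= l -> l < r -> r <= e -> e < e' -> t <= l \/ e' <= t ->
  step_fun f f' l r e e' t = 0.
Proof.
move=> ff' f'l lr re ee' tle; rewrite /step_fun !relu_bump//; try lra.
case: tle => [tl|te].
  have te : t <= e by lra.
  by rewrite te !relu_eq0 ?subrr ?mul0r//; lra.
have h : (e' - t) / (e' - e) <= 0 by rewrite ler_pdivrMr ?mul0r; lra.
have [te'|_] := leP t e; first lra.
by rewrite !relu_eq0 ?subrr ?mul0r; rewrite ?(mulr_ge0_le0 _ h)//; lra.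
Qed.

(** At most one term is nonzero, so the positive part acts termwise. This is how a single neuron
    produces one ramp in every block. *)
Lemma relu_sum_disjoint (R : realType) (J : finType) (h u : J -> R) :
  (forall j, 0 <= h j) -> (forall j j', j != j' -> u j = 0 \/ u j' = 0) ->
  relu (\sum_j h j * u j) = \sum_j h j * relu (u j).
Proof.
move=> h0 u0; have [[j uj]|nu] := pselect (exists j, u j != 0).
  have uj' j' : j' != j -> u j' = 0.
    by move=> /u0[//|uj0]; rewrite uj0 eqxx in uj.
  rewrite (bigD1 j)//= big1 => [|j' /uj'->]; last by rewrite mulr0.
  rewrite addr0 reluM// [RHS](bigD1 j)//= big1 ?addr0// => j' /uj'->.
  by rewrite relu_eq0 ?mulr0.
have {}u0 j : u j = 0 by apply/eqP/negPn/negP => uj; apply: nu; exists j.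
by rewrite !big1 ?relu_eq0// => j _; rewrite u0 ?relu_eq0 ?mulr0.
Qed.

Lemma sum_ord_mul (R : realType) (n m : nat) (F : nat -> R) :
  \sum_(i < n) \sum_(j < m) F (i * m + j)%N = \sum_(k < n * m) F k.
Proof.
elim: n => [|n IH]; first by rewrite !big_ord0.
rewrite big_ord_recr /= IH mulSnr big_split_ord /=; congr (_ + _).
Qed.

(** A point of the gap before [A k]. Block boundaries are taken there: the descent ending one block
    stops exactly where the next block starts. *)
Definition cut (R : realType) (A B : nat -> R) (k : nat) : R :=
  if k is k'.+1 then (B k' + A k) / 2 else A 0%N - 1.

Definition lft (R : realType) (A B : nat -> R) (k : nat) : R :=
  (cut A B k + A k) / 2.

(* Intervals [A k, B k] come in blocks of K; the k-th step function climbs just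
   before A k and drops back just after the end of the block of k. *)
Definition block_step (R : realType) (A B : nat -> R) (K k : nat) (t : R) : R :=
  step_fun (cut A B (k %/ K * K)) (lft A B (k %/ K * K)) (lft A B k) (A k)
    (B (k %/ K * K + K.-1)%N) (cut A B ((k %/ K).+1 * K)) t.

(** The jump of height at the k-th climb. All steps of the previous block have dropped back to 0
    when a block begins, so its first jump is the full height. *)
Definition increment (R : realType) (d K : nat) (x : nat -> 'I_d -> R) (k : nat)
    (i : 'I_d) : R :=
  x k i - (if (k %% K)%N == 0%N then 0 else x k.-1 i).

(** These are the order conditions under which [step_fun] is a trapezoid. *)
Lemma block_nodes (R : realType) (A B : nat -> R) (K k : nat) :
  (0 < K)%N -> (forall k, A k < B k) -> (forall k, B k < A k.+1) ->
  [/\ cut A B (k %/ K * K) < lft A B (k %/ K * K),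
      lft A B (k %/ K * K) <= lft A B k, lft A B k < A k,
      A k <= B (k %/ K * K + K.-1)%N &
      B (k %/ K * K + K.-1)%N < cut A B ((k %/ K).+1 * K)].
Proof.
move=> K0 AB BA.
have cA j : cut A B j < A j.
  by case: j => [|j] /=; [|have := BA j]; lra.
have Bc j : B j < cut A B j.+1 by have /= := BA j; lra.
have lA j : lft A B j < A j by have := cA j; rewrite /lft; lra.
have cl j : cut A B j < lft A B j by have := cA j; rewrite /lft; lra.
have ndl : nondecreasing_seq (lft A B).
  apply/nondecreasing_seqP => j.
  by have := lA j; have := AB j; have := Bc j; have := cl j.+1; lra.
have ndB : nondecreasing_seq B.
  by apply/nondecreasing_seqP => j; have := BA j; have := AB j.+1; lra.
split=> //.
- by apply: ndl; exact: leq_trunc_div.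
- apply: le_trans (ltW (AB k)) _; apply: ndB.
  by rewrite -ltnS -addnS prednK// -mulSnr ltn_ceil.
- by rewrite mulSnr -[X in cut _ _ (_ + X)%N](prednK K0) addnS.
Qed.

Lemma block_step_ge0_le1 (R : realType) (A B : nat -> R) (K k : nat) (t : R) :
  (0 < K)%N -> (forall k, A k < B k) -> (forall k, B k < A k.+1) ->
  0 <= block_step A B K k t <= 1.
Proof.
move=> K0 AB BA; have [h1 h2 h3 h4 h5] := block_nodes k K0 AB BA.
exact: step_fun_ge0_le1.
Qed.

(** On the k-th plateau, steps of later index have not begun to climb and steps of earlier blocks
    have already dropped back to 0. *)
Lemma block_step_plateau (R : realType) (A B : nat -> R) (K j k : nat) (t : R) :
  (0 < K)%N -> (forall k, A k < B k) -> (forall k, B k < A k.+1) ->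
  A k <= t <= B k ->
  block_step A B K j t = ((k %/ K * K <= j)%N && (j <= k)%N)%:R.
Proof.
move=> K0 AB BA /andP[At tB].
have [h1 h2 h3 h4 h5] := block_nodes j K0 AB BA.
have ndA : nondecreasing_seq A.
  by apply/nondecreasing_seqP => i; have := AB i; have := BA i; lra.
have ndB : nondecreasing_seq B.
  by apply/nondecreasing_seqP => i; have := BA i; have := AB i.+1; lra.
have ndc : nondecreasing_seq (cut A B).
  apply/nondecreasing_seqP => i.
  have : A i < cut A B i.+1 by have /= := BA i; have := AB i; lra.
  have : cut A B i < A i by case: i => [|i] /=; [|have := BA i]; lra.
  by lra.
have [jk|kj] := leqP j k; last first.
  rewrite andbF; apply: step_fun_eq0 => //; left; apply: le_trans tB _.
  case: j kj {h1 h2 h3 h4 h5} => // j kj; have := ndB _ _ (kj : (k <= j)%N).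
  by have := BA j; rewrite /lft /=; lra.
rewrite andbT; have [bj|jb] := leqP.
  have jkK : (j %/ K = k %/ K)%N.
    by apply/eqP; rewrite eqn_leq leq_div2r//= leq_divRL.
  apply: step_fun_eq1 => //; rewrite (le_trans (ndA _ _ jk) At) /=.
  apply: le_trans tB _; apply: ndB; rewrite jkK.
  by rewrite -ltnS -addnS prednK// -mulSnr ltn_ceil.
apply: step_fun_eq0 => //; right.
have /ndc : ((j %/ K).+1 * K <= k)%N.
  by apply: leq_trans (leq_trunc_div k K); rewrite leq_mul2r ltn_divLR// jb orbT.
have : cut A B k < A k by case: (k) => [|i] /=; [|have := BA i]; lra.
by lra.
Qed.

Lemma sum_increment (R : realType) (d K : nat) (x : nat -> 'I_d -> R) (k : nat)
    (i : 'I_d) : (0 < K)%N ->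
  \sum_(k %/ K * K <= j < k.+1) increment K x j i = x k i.
Proof.
move=> K0; rewrite {2 3}(divn_eq k K); have := ltn_pmod k K0.
move: (k %/ K)%N (k %% K)%N => b; elim=> [_|r IH rK].
  by rewrite addn0 big_nat1 /increment modnMl eqxx subr0.
rewrite big_nat_recr /=; last exact: leq_addr.
rewrite addnS IH; last exact: ltnW.
rewrite /increment /= -addnS modnMDl modn_small//=.
by rewrite addnS /=; ring.
Qed.

Lemma sum_increment_plateau (R : realType) (d N K k : nat) (A B : nat -> R)
    (x : nat -> 'I_d -> R) (t : R) (i : 'I_d) :
  (0 < K)%N -> (forall k, A k < B k) -> (forall k, B k < A k.+1) ->
  A k <= t <= B k -> (k < N)%N ->
  \sum_(j < N) increment K x j i * block_step A B K j t = x k i.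
Proof.
move=> K0 AB BA tAB kN.
rewrite -[RHS](sum_increment x k i K0) (big_nat_widen _ _ N)//.
rewrite (big_nat_widenl _ 0%N)// big_mkord [RHS]big_mkcond /=.
apply: eq_bigr => j _; rewrite (block_step_plateau _ K0 AB BA tAB) ltnS andbC.
by case: ifP; rewrite ?mulr1 ?mulr0.
Qed.

Lemma sum_pair (R : realType) (I J : finType) (F : I * J -> R) :
  \sum_p F p = \sum_i \sum_j F (i, j).
Proof. by rewrite pair_bigA; apply: eq_bigr => -[]. Qed.

(** The first layer needs four breakpoints for each of the [m] blocks. The second needs four neurons
    for each rank and coordinate: two ends of a climb times two signs. So [m * K] steps cost only
    [4 * m] and [4 * d * K] neurons. *)
Lemma block_steps_module (R : realType) (d w m K r : nat) (A B : nat -> R)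
    (D : nat -> 'I_d -> R) :
  (0 < K)%N -> (forall k, A k < B k) -> (forall k, B k < A k.+1) ->
  (4 * m <= w)%N -> (4 * d * K <= w)%N ->
  relu_module w (fun t i => \sum_(j < m) \sum_(l < K)
    D ((r * m + j) * K + l)%N i * block_step A B K ((r * m + j) * K + l) t).
Proof.
move=> K0 AB BA mw dKw.
pose sg (b : bool) : R := if b then 1 else -1.
pose f j := cut A B (j * K); pose f' j := lft A B (j * K).
pose e j := B (j * K + K.-1)%N; pose e' j := cut A B (j.+1 * K).
pose z (b : bool) k := if b then lft A B k else A k.
pose blk (j : 'I_m) := (r * m + j)%N.
pose K1 : finType := ('I_m * (bool * bool))%type.
pose K2 : finType := (('I_K * bool) * ('I_d * bool))%type.
(* A neuron of the second layer is given by a rank in the block, a node of the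
   climb (its start or its end), a coordinate and the sign of the increment. *)
pose nid (s : K2) (j : 'I_m) := (blk j * K + s.1.1)%N.
(* Only nonnegative weights pass through the positive part, so the slope of each climb is split into
   its positive and negative parts. *)
pose h (s : K2) (j : 'I_m) : R := relu (sg s.2.2 *
  (D (nid s j) s.2.1 / (A (nid s j) - lft A B (nid s j)))).
pose u (s : K2) (j : 'I_m) t :=
  bump (f (blk j)) (f' (blk j)) (z s.1.2 (nid s j)) (e (blk j)) (e' (blk j)) t.
pose xi (k : K1) : R := match k.2 with
  | (true, true) => f (blk k.1) | (true, false) => f' (blk k.1)
  | (false, true) => e (blk k.1) | (false, false) => e' (blk k.1) end.
pose c (s : K2) (k : K1) : R :=
  let j := blk k.1 in let zj := z s.1.2 (nid s k.1) in
  let sl := (zj - f' j) / (f' j - f j) in let sl' := (e j - zj) / (e' j - e j) in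
  h s k.1 * match k.2 with
  | (true, true) => - sl | (true, false) => 1 + sl
  | (false, true) => - (1 + sl') | (false, false) => sl' end.
(* The two signs recombine start minus end of the climb, and positive minus negative part of the
   slope. *)
pose V (i : 'I_d) (s : K2) : R := (i == s.2.1)%:R * (sg s.1.2 * sg s.2.2).
exists K1, K2, xi, c, V; split.
- by rewrite !card_prod card_bool card_ord mulnC.
- rewrite !card_prod !card_ord !card_bool; apply: leq_trans dKw.
  by apply: eq_leq; lia.
move=> t i.
have nidK s j : (nid s j %/ K)%N = blk j.
  by rewrite divnMDl// divn_small ?addn0.
have sE s : \sum_k c s k * relu (t - xi k) = \sum_j h s j * u s j t.
  rewrite sum_pair; apply: eq_bigr => j _.
  by rewrite sum_pair !big_bool /= /c /xi /u /bump /=; ring.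
have uh s : relu (\sum_k c s k * relu (t - xi k)) = \sum_j h s j * relu (u s j t).
  rewrite sE relu_sum_disjoint// => [j|j j' jj']; first exact: relu_ge0.
  have ndc : nondecreasing_seq (cut A B).
    apply/nondecreasing_seqP => n.
    have : A n < cut A B n.+1 by have /= := BA n; have := AB n; lra.
    have : cut A B n < A n by case: (n) => [|n'] /=; [|have := BA n']; lra.
    by lra.
  have u0 a : t <= f (blk a) \/ e' (blk a) <= t -> u s a t = 0.
    have [] := block_nodes (nid s a) K0 AB BA; rewrite nidK => h1 h2 h3 h4 h5.
    by apply: bump_out => //; rewrite /f' /e; lra.
  (* Bumps of different blocks have disjoint supports: the earlier one ends no later than the other
     begins. *)
  wlog lt_jj' : j j' jj' / (j < j')%N => [hw|].
    have := jj'; rewrite neq_ltn => /orP[/(hw _ _ jj')//|].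
    by rewrite eq_sym in jj'; move=> /(hw _ _ jj') [] ->; [right|left].
  have e'f : e' (blk j) <= f (blk j').
    by apply: ndc; rewrite leq_mul2r -addnS leq_add2l lt_jj' orbT.
  have [te|te] := leP (e' (blk j)) t; [left|right]; apply: u0; first by right.
  by left; apply: le_trans (ltW te) e'f.
under [RHS]eq_bigr do rewrite uh.
rewrite !sum_pair exchange_big /=; apply: eq_bigr => l _.
have qE b : \sum_q V i ((l, b), q) *
     (\sum_j h ((l, b), q) j * relu (u ((l, b), q) j t)) =
   sg b * \sum_j D (blk j * K + l)%N i /
       (A (blk j * K + l)%N - lft A B (blk j * K + l)) *
       relu (bump (f (blk j)) (f' (blk j)) (z b (blk j * K + l)%N) (e (blk j))
         (e' (blk j)) t).
  rewrite sum_pair (bigD1 i)//= [X in _ + X]big1 ?addr0; last first.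
    move=> o oi; rewrite big1// => s _.
    by rewrite /V /= eq_sym (negPf oi) !mul0r.
  rewrite big_bool /= /V /= eqxx !mul1r mulr1 mulrN1 mulNr -mulrBr -sumrB.
  congr (_ * _); apply: eq_bigr => j _.
  by rewrite -mulrBl /h /nid /= mul1r mulN1r relu_subN.
rewrite big_bool /= !qE /sg mul1r mulN1r -sumrB; apply: eq_bigr => j _.
rewrite /block_step /step_fun -/(nid ((l, true), (i, true)) j) nidK /nid /=.
by rewrite -/(blk j) /f /f' /e /e' /=; ring.
Qed.

(** The bound [M] is chosen before the intervals: steps lie between 0 and 1, so it depends on the
    increments of the heights only. The intervals can then be fitted as tightly as [M] demands. *)
Lemma plateau_net (R : realType) (d W L m n K : nat) (x : nat -> 'I_d -> R) :
  (0 < K)%N -> (2 * d.+1 + 4 * m <= W)%N -> (2 * d.+1 + 4 * d * K <= W)%N ->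
  (n.*2 <= L)%N ->
  exists M : R, forall A B : nat -> R,
    (forall k, A k < B k) -> (forall k, B k < A k.+1) ->
  exists f : relu_net R 1 d, [/\ (net_width f <= W)%N, (net_depth f <= L)%N,
    forall k t i, (k < n * m * K)%N -> A k <= t <= B k ->
      tnth (net_fun f t) i = x k i &
    forall t i, `|tnth (net_fun f t) i : R| <= M].
Proof.
move=> K0 mW KW nL.
exists (\sum_i \sum_(j < n * m * K) `|increment K x j i|) => A B AB BA.
have wW : (2 * d.+1 + (W - 2 * d.+1) <= W)%N.
  by rewrite subnKC//; apply: leq_trans mW; rewrite leq_addr.
have /(sum_modules_net) /(_ wW nL)[f [fw fl fE]] := fun r =>
  @block_steps_module R d (W - 2 * d.+1) m K r A B (increment K x) K0 AB BA
    ltac:(by rewrite leq_subRL; lia) ltac:(by rewrite leq_subRL; lia).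
have {}fE t i : tnth (net_fun f t) i =
    \sum_(j < n * m * K) increment K x j i * block_step A B K j t.
  rewrite fE (sum_ord_mul n m (fun a => \sum_(l < K)
    increment K x (a * K + l)%N i * block_step A B K (a * K + l) t)).
  exact: (sum_ord_mul (n * m) K
    (fun k => increment K x k i * block_step A B K k t)).
exists f; split=> // [k t i kN tAB|t i]; rewrite fE.
  exact: sum_increment_plateau.
apply: le_trans (ler_norm_sum _ _ _) _; rewrite [leRHS](bigD1 i)//= ler_wpDr//.
  by apply: sumr_ge0 => ? _; exact: sumr_ge0.
apply: ler_sum => j _; rewrite normrM ler_piMr//.
have /andP[s0 s1] := block_step_ge0_le1 j t K0 AB BA.
by rewrite ger0_norm.
Qed.

(** * Splitting a law without atoms *)

Local Open Scope ereal_scope.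

(** An intermediate value argument at the infimum [t0] of the points where the distribution function
    is at least [s], which exists by the limits 0 and 1 at infinity. Continuity from the right
    bounds the value at [t0] from below; continuity from the left, due to the absence of atoms,
    bounds it from above. *)
Lemma cdf_quantile (R : realType) (nu : probability (measurableTypeR R) R)
    (s : R) :
  nu `<< lebesgue_measure -> (0 < s < 1)%R ->
  exists t : R, nu `]-oo, t]%classic = s%:E.
Proof.
move=> nul /andP[s0 s1].
pose F (t : R) := nu `]-oo, t]%classic.
have ndF : {homo F : x y / (x <= y)%R >-> x <= y}.
  by move=> x y xy; rewrite le_measure ?inE//; exact: subitvPr.
have FE t : F t = (fine (F t))%:E by rewrite fineK// fin_num_measure.
pose idR : measurableTypeR R -> R := idfun.
pose idR_mfun : {RV nu >-> R} :=
  HB.pack idR (isMeasurableFun.Build _ _ _ _ idR (@measurable_id _ (measurableTypeR R) setT)).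
have Fy : F t @[t --> +oo%R] --> 1 := cvg_cdfy1 idR_mfun.
have FNy : F t @[t --> -oo%R] --> 0 := cvg_cdfNy0 idR_mfun.
pose S := [set t | s%:E <= F t].
have S0 : S !=set0.
  have [t Ft] := filter_ex (cvgr_gt _ (fine_cvg Fy) s s1).
  by exists t; rewrite /S /= FE lee_fin ltW.
have lbS : has_lbound S.
  have [t Ft] := filter_ex (cvgr_lt _ (fine_cvg FNy) s s0).
  exists t => x; rewrite /S /= leNgt => sFx; rewrite leNgt; apply: contra sFx.
  by move=> /ltW/ndF /le_lt_trans; apply; rewrite FE lte_fin.
pose t0 := inf S.
have lS t : (t0 < t)%R -> s%:E <= F t.
  by move=> /(inf_lt S0)[x Sx /ltW/ndF]; exact: le_trans.
have uS t : (t < t0)%R -> F t <= s%:E.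
  move=> tt0; apply/ltW; rewrite ltNge; apply/negP => St.
  by have := ge_inf lbS St; rewrite leNgt tt0.
exists t0; apply/eqP; rewrite eq_le; apply/andP; split.
  (* The point [t0] is Lebesgue-null, hence null for [nu]. *)
  have -> : nu `]-oo, t0]%classic = nu `]-oo, t0[%classic.
    have -> : `]-oo, t0]%classic = `]-oo, t0[%classic `|` [set t0].
      by rewrite setUitv1.
    rewrite measureU//.
      have /null_content_dominatesP nul' := nul.
      rewrite [X in _ + X](_ : _ = 0) ?adde0//.
      exact: (nul' [set t0] (measurable_set1 t0) (lebesgue_measure_set1 t0)).
    by apply/seteqP; split => // x /= [/[swap]->]; rewrite in_itv /= ltxx.
  have cF : F (t0 - n.+1%:R^-1)%R @[n --> \oo] --> nu `]-oo, t0[%classic.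
    have -> : `]-oo, t0[%classic =
        \bigcup_n `]-oo, (t0 - n.+1%:R^-1)%R]%classic.
      apply/seteqP; split=> x; last first.
        move=> [n _] /=; rewrite !in_itv /= => /le_lt_trans; apply.
        by rewrite ltrBlDr ltrDl.
      rewrite /= in_itv /= => xt0.
      exists (Num.truncn (t0 - x)^-1%R) => //=; rewrite in_itv /= lerBrDl -lerBrDr.
      rewrite invf_ple ?posrE ?subr_gt0//; exact/ltW/truncnS_gt.
    apply: nondecreasing_cvg_mu => [//||m n mn].
      exact: bigcup_measurable.
    apply/subsetPset; apply: subset_itvl.
    by rewrite bnd_simp lerD2l lerN2 lef_pV2 ?posrE// ler_nat.
  apply: (cvge_to_le cF); apply: nearW => n; apply: uS.
  by rewrite ltrBlDr ltrDl invr_gt0.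
have cF : F (t0 + n.+1%:R^-1)%R @[n --> \oo] --> F t0.
  rewrite /F [in X in _ --> X](itvNycEbigcap false).
  apply: nonincreasing_cvg_mu => [|//||m n mn].
  - by rewrite -ge0_fin_numE// fin_num_measure.
  - exact: bigcap_measurable.
  - apply/subsetPset; apply: subset_itvl.
    by rewrite bnd_simp lerD2l lef_pV2 ?posrE// ler_nat.
apply: (cvge_to_ge cF); apply: nearW => n; apply: lS.
by rewrite ltrDl invr_gt0.
Qed.

Definition cdfr (R : realType) (nu : probability (measurableTypeR R) R) (t : R)
    : R := fine (nu `]-oo, t]%classic).

Lemma cdfr_nondecreasing (R : realType)
    (nu : probability (measurableTypeR R) R) :
  {homo cdfr nu : x y / (x <= y)%R}.
Proof.
move=> x y xy; apply: fine_le; rewrite ?fin_num_measure//.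
by rewrite le_measure ?inE//; exact: subitvPr.
Qed.

Lemma measurable_cdfr (R : realType) (nu : probability (measurableTypeR R) R) :
  measurable_fun [set: measurableTypeR R] (cdfr nu).
Proof. by apply: nondecreasing_measurable => //; exact: cdfr_nondecreasing. Qed.

Lemma cdfr_quantile (R : realType) (nu : probability (measurableTypeR R) R)
    (s : R) :
  nu `<< lebesgue_measure -> (0 < s < 1)%R -> exists t, cdfr nu t = s.
Proof. by move=> nul /(cdf_quantile nul)[t ts]; exists t; rewrite /cdfr ts. Qed.

Lemma measurable_cdfr_le (R : realType) (nu : probability (measurableTypeR R) R)
    (s : R) : measurable ([set t | cdfr nu t <= s]%R : set (measurableTypeR R)).
Proof.
rewrite -[X in measurable X]setTI.
have -> : [set t | (cdfr nu t <= s)%R] = cdfr nu @^-1` `]-oo, s]%classic.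
  by apply/seteqP; split=> t /=; rewrite in_itv.
exact: measurable_cdfr.
Qed.

(** The probability integral transform: under [nu], its own distribution function is uniformly
    distributed. *)
Lemma cdfr_uniform (R : realType) (nu : probability (measurableTypeR R) R)
    (s : R) :
  nu `<< lebesgue_measure -> (0 <= s <= 1)%R ->
  nu [set t | (cdfr nu t <= s)%R] = s%:E.
Proof.
move=> nul /andP[s0 s1].
have mF := measurable_cdfr_le nu s.
have cdfE t : nu `]-oo, t]%classic = (cdfr nu t)%:E.
  by rewrite fineK// fin_num_measure.
have [->|s1N] := eqVneq s 1%R.
  rewrite (_ : [set t | _] = setT) ?probability_setT//.
  apply/seteqP; split=> // t _ /=.
  by rewrite -lee_fin -cdfE probability_le1.
have {s1N}s1 : (s < 1)%R by rewrite lt_neqAle s1N.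
apply/eqP; rewrite eq_le; apply/andP; split.
  have m1 : nu [set t | (cdfr nu t <= s)%R] <= 1 by exact: probability_le1.
  have : nu [set t | (cdfr nu t <= s)%R] \is a fin_num by rewrite fin_num_measure.
  move: m1; case mE : (nu _) => [m| |]// m1 _; rewrite lee_fin in m1 *.
  rewrite leNgt; apply/negP; rewrite lte_fin => sm.
  (* If the mass [m] exceeded [s], the sublevel set would lie in the half-line ending at the
     quantile of the intermediate level, whose mass is below [m]. *)
  have [t tE] : exists t, cdfr nu t = ((s + m) / 2)%R.
    by apply: cdfr_quantile => //; apply/andP; split; lra.
  have : m%:E <= ((s + m) / 2)%:E.
    rewrite -mE -tE -cdfE le_measure ?inE// => x /= xs; rewrite in_itv /= leNgt.
    apply/negP => /ltW /(@cdfr_nondecreasing _ nu); rewrite tE => ?; lra.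
  by rewrite lee_fin; lra.
have [->//|s0N] := eqVneq s 0%R.
have {s0N}s0 : (0 < s)%R by rewrite lt_neqAle eq_sym s0N.
have [t ts] := cdfr_quantile nul (introT andP (conj s0 s1)).
rewrite -[leLHS](_ : nu `]-oo, t]%classic = _) ?cdfE ?ts//.
rewrite -ts -cdfE le_measure ?inE//; first by rewrite ts.
by move=> x /=; rewrite in_itv /=; exact: cdfr_nondecreasing.
Qed.

Lemma measurable_cdfr_band (R : realType)
    (nu : probability (measurableTypeR R) R) (s s' : R) :
  measurable ([set t | s < cdfr nu t <= s']%R : set (measurableTypeR R)).
Proof.
rewrite (_ : [set t | _] = [set t | cdfr nu t <= s']%R `\` [set t | cdfr nu t <= s]%R).
  by apply: measurableD; exact: measurable_cdfr_le.
apply/seteqP; split => t /=; first by rewrite ltNge => /andP[/negP ? ->].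
by rewrite ltNge => -[-> /negP ->].
Qed.

Lemma cdfr_band (R : realType) (nu : probability (measurableTypeR R) R)
    (s s' : R) :
  nu `<< lebesgue_measure -> (0 <= s)%R -> (s <= s')%R -> (s' <= 1)%R ->
  nu [set t | (s < cdfr nu t <= s')%R] = (s' - s)%:E.
Proof.
move=> nul s0 ss' s1.
rewrite (_ : [set t | _] = [set t | cdfr nu t <= s']%R `\` [set t | cdfr nu t <= s]%R).
  rewrite measureD; [|exact: measurable_cdfr_le|exact: measurable_cdfr_le|].
    rewrite setIidr; last by move=> t /= /le_trans; exact.
    rewrite EFinB; congr (_ - _); apply: cdfr_uniform => //.
      by rewrite (le_trans s0 ss').
    by rewrite s0 (le_trans ss').
  by rewrite -ge0_fin_numE// fin_num_measure//; exact: measurable_cdfr_le.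
apply/seteqP; split => t /=; first by rewrite ltNge => /andP[/negP ? ->].
by rewrite ltNge => -[-> /negP ->].
Qed.

(* J k is the fiber of the distribution function over ]P k, P k.+1], P being the
   partial sums of p. The intervals of index at least n are fillers, for the
   plateaus that a network has in excess. *)
Lemma cdfr_tiling (R : realType) (nu : probability (measurableTypeR R) R)
    (n : nat) (p : nat -> R) (e : R) :
  nu `<< lebesgue_measure -> (0 < n)%N -> (forall k, 0 <= p k)%R ->
  (forall k, (k < n)%N -> 0 < p k)%R -> (\sum_(k < n) p k = 1)%R ->
  (0 < e <= 1)%R ->
  exists (A B : nat -> R) (J : nat -> set (measurableTypeR R)), [/\
    (forall k, A k < B k)%R /\ (forall k, B k < A k.+1)%R,
    forall k, measurable (J k), trivIset setT J,
    forall k, (k < n)%N -> nu (J k) = (p k)%:E &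
    forall k, (k < n)%N -> nu (J k `\` `[A k, B k]%classic) <= (e * p k)%:E].
Proof.
move=> nul n0 p0 pn p1 /andP[e0 e1].
pose P k : R := (\sum_(i < k) p i)%R.
have PS k : P k.+1 = (P k + p k)%R by rewrite /P big_ord_recr.
have ndP : nondecreasing_seq P.
  by apply/nondecreasing_seqP => k; rewrite PS lerDl.
have Pge0 k : (0 <= P k)%R by rewrite sumr_ge0.
have Ple1 k : (k <= n)%N -> (P k <= 1)%R by rewrite -p1; exact: ndP.
(* A fraction [th] of the mass of [J k] is left out at each end, which separates consecutive
   intervals strictly. *)
pose th := (e / 3)%R.
have th0 : (0 < th)%R by rewrite divr_gt0.
have th3 : (th <= 1 / 3)%R by rewrite /th; lra.
have thp k : (k < n)%N -> (0 < th * p k)%R by move=> kn; rewrite mulr_gt0 ?pn.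
have thp' k : (th * p k <= p k / 3)%R by have := p0 k; nra.
have AE k : exists a, (k < n)%N -> cdfr nu a = (P k + th * p k)%R.
  have [kn|kn] := leqP n k; first by exists 0%R.
  suff /(cdfr_quantile nul)[a ?] : (0 < P k + th * p k < 1)%R by exists a.
  have := thp _ kn; have := thp' k; have := Pge0 k; have := Ple1 _ kn.
  by rewrite PS; have := pn _ kn; lra.
have BE k : exists b, (k < n)%N -> cdfr nu b = (P k.+1 - th * p k)%R.
  have [kn|kn] := leqP n k; first by exists 0%R.
  suff /(cdfr_quantile nul)[a ?] : (0 < P k.+1 - th * p k < 1)%R by exists a.
  have := thp _ kn; have := thp' k; have := Pge0 k; have := Ple1 _ kn.
  by rewrite PS; have := pn _ kn; lra.
have {AE}[a aE] := choice AE; have {BE}[b bE] := choice BE.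
have lt_cdf x y : (cdfr nu x < cdfr nu y)%R -> (x < y)%R.
  by rewrite !ltNge; apply: contra; exact: cdfr_nondecreasing.
(* The fillers are unit intervals, one unit apart, to the right of the last true interval. *)
pose A k := if (k < n)%N then a k else (b n.-1 + (2 * k)%:R)%R.
pose B k := if (k < n)%N then b k else (b n.-1 + (2 * k).+1%:R)%R.
pose J k : set (measurableTypeR R) := [set t | (P k < cdfr nu t <= P k.+1)%R].
exists A, B, J; split.
- split=> k; rewrite /A /B.
    case: ifPn => kn; last by rewrite ltrD2l ltr_nat.
    apply: lt_cdf; rewrite aE// bE// PS.
    by have := thp _ kn; have := thp' k; lra.
  have [kn|kn] := ltnP k.+1 n.
    rewrite (ltnW kn); apply: lt_cdf; rewrite aE// bE//; last exact: ltnW.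
    by have := thp _ kn; have := thp _ (ltnW kn); lra.
  case: ifPn => kn'; last by rewrite ltrD2l ltr_nat mulnS.
  have -> : k = n.-1 by apply/eqP; rewrite eqn_leq -ltnS prednK// kn' -ltnS prednK.
  by rewrite ltrDl ltr0n prednK// muln_gt0.
- by move=> k; exact: measurable_cdfr_band.
- apply/trivIsetP => i j _ _.
  wlog ij : i j / (i < j)%N => [hw|_].
    by rewrite neq_ltn => /orP[] ?; [|rewrite setIC]; apply: hw => //;
      rewrite neq_ltn; apply/orP; left.
  apply/seteqP; split=> // t [] /= /andP[_ ti] /andP[tj _].
  by have := ndP _ _ ij; lra.
- move=> k kn; rewrite cdfr_band//; [|exact: ndP|exact: Ple1].
  by rewrite PS addrC addKr.
- move=> k kn.
  pose U : set (measurableTypeR R) := [set t | (P k < cdfr nu t <= P k + th * p k)%R].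
  (* To the right of [B k] the distribution function is only known to be at least its value there;
     doubling the slice gives the strict inequality. The total lost is [3 * th = e], relative to
     [p k]. *)
  pose V : set (measurableTypeR R) := [set t | (P k.+1 - 2 * (th * p k) < cdfr nu t <= P k.+1)%R].
  have := thp _ kn; have := thp' k; have := Pge0 k; have := Ple1 _ kn.
  rewrite PS => h1 h2 h3 h4.
  apply: (@le_trans _ _ (nu (U `|` V))).
    rewrite le_measure ?inE//.
    - by apply: measurableD; [exact: measurable_cdfr_band|exact: measurable_itv].
    - by apply: measurableU; exact: measurable_cdfr_band.
    move=> t [] /= /andP[tP tP'] /negP; rewrite in_itv /= /A /B kn negb_and -!ltNge.
    move=> /orP[] /ltW /(@cdfr_nondecreasing _ nu); rewrite ?aE ?bE// => ct.
      by left; rewrite /U /= tP ct.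
    by right; rewrite /V /= tP' andbT; lra.
  apply: (@le_trans _ _ (nu U + nu V)).
    by apply: measureU2; exact: measurable_cdfr_band.
  have -> : nu U = (th * p k)%:E.
    by rewrite cdfr_band//; [congr EFin; lra|lra..].
  have -> : nu V = (2 * (th * p k))%:E.
    by rewrite cdfr_band// ?PS; [congr EFin; lra|lra..].
  by rewrite -EFinD lee_fin /th; lra.
Qed.

(** * The block coupling *)

Lemma measurable_enorm (R : realType) (d : nat) :
  measurable_fun [set: euclid R d] (@enorm R d).
Proof.
apply: (measurableT_comp (f := @Num.sqrt R)).
  by apply: continuous_measurable_fun; exact: sqrt_continuous.
by apply: measurable_sum => i; apply: measurable_funX; exact: measurable_tnth.
Qed.

Lemma measurable_esub (R : realType) (d : nat) :
  measurable_fun [set: (euclid R d * euclid R d)%type]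
    (fun z => esub z.1 z.2).
Proof.
apply/measurable_fun_tnthP => i; rewrite /comp /esub.
under eq_fun do rewrite tnth_mktuple.
apply: measurable_funB.
  exact: (measurableT_comp (measurable_tnth i) measurable_fst).
exact: (measurableT_comp (measurable_tnth i) measurable_snd).
Qed.

Lemma measurable_dist_powR (R : realType) (d : nat) (p : R) :
  measurable_fun [set: (euclid R d * euclid R d)%type]
    (fun z => ((enorm (esub z.1 z.2) `^ p)%R)%:E).
Proof.
apply/measurable_EFinP; apply: (measurableT_comp (measurable_powR p)).
exact: (measurableT_comp (@measurable_enorm R d) (@measurable_esub R d)).
Qed.

Lemma sum_measure_partition (d : measure_display) (T : measurableType d)
    (R : realType) (m : probability T R) (n : nat) (E : nat -> set T)
    (A : set T) :
  (forall k, measurable (E k)) -> trivIset setT E ->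
  \sum_(k < n) m (E k) = 1 -> measurable A ->
  \sum_(k < n) m (A `&` E k) = m A.
Proof.
move=> mE tE E1 mA.
pose U := \big[setU/set0]_(k < n) E k.
have mU : measurable U by exact: bigsetU_measurable.
have mU1 : m U = 1.
  rewrite measure_bigsetU_ord//.
  apply/trivIsetP => i j _ _ ij; move/trivIsetP: tE; apply => //.
have mUC : measurable (~` U) by exact: measurableC.
have mCU : m (~` U) = 0 by rewrite probability_setC// mU1 subee.
have -> : m A = m (A `&` U).
  rewrite -[in LHS](setIT A) -(setUv U) setIUr measureU//.
  - rewrite [X in _ + X](_ : _ = 0) ?adde0//; apply/eqP.
    rewrite -measure_le0 -mCU le_measure ?inE//.
    by apply: measurableI => //; exact: measurableC.
  - exact: measurableI.
  - by apply: measurableI => //; exact: measurableC.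
  - by rewrite setIACA setICr setI0.
rewrite /U big_distrr/= measure_bigsetU_ord// => [i|]; first exact: measurableI.
apply/trivIsetP => i j _ _ ij; rewrite setIACA.
by move/trivIsetP: tE => -> //; rewrite setI0.
Qed.

Lemma ge0_integral_mrestr (d : measure_display) (T : measurableType d)
    (R : realType) (m : {measure set T -> \bar R}) (D : set T)
    (mD : measurable D) (f : T -> \bar R) :
  measurable_fun setT f -> (forall x, 0 <= f x) ->
  \int[mrestr m mD]_x f x = \int[m]_(x in D) f x.
Proof.
move=> mf f0.
rewrite (@ge0_negligible_integral _ _ _ _ setT (~` D))//; last 2 first.
- exact: measurableC.
- by rewrite /= /mrestr setICl measure0.
rewrite setTD setCK; apply: eq_measure_integral => A mA AD.
by rewrite /= /mrestr setIidl.
Qed.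

Lemma exists_probability (d : measure_display) (T : measurableType d)
    (R : realType) (m : {measure set T -> \bar R}) :
  m setT = 1 -> exists P : probability T R, forall A, P A = m A.
Proof.
move=> m1.
exists (mnormalize m \d_point) => A.
by rewrite /= /mnormalize m1 onee_eq0 /= invr1 mule1.
Qed.

(** The coupling is the image under (x, t) -> (x, phi t) of the measure that on each [E k] x [J k]
    is the product measure divided by [w k]. Both marginals are right because [E k] and [J k] have
    the same mass [w k] and each family has total mass 1. *)
Lemma wasserstein_tiling (R : realType) (d : nat) (p : R)
    (mu : probability (euclid R d) R)
    (nu : probability (measurableTypeR R) R)
    (phi : {mfun measurableTypeR R >-> euclid R d}) (n : nat)
    (E : nat -> set (euclid R d)) (J : nat -> set (measurableTypeR R))
    (w : nat -> R) (H : euclid R d -> R) :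
  (1 <= p)%R ->
  (forall k, measurable (E k)) -> (forall k, measurable (J k)) ->
  trivIset setT E -> trivIset setT J -> (forall k, 0 <= w k)%R ->
  (forall k, (k < n)%N -> 0 < w k)%R -> (\sum_(k < n) w k = 1)%R ->
  (forall k, (k < n)%N -> mu (E k) = (w k)%:E) ->
  (forall k, (k < n)%N -> nu (J k) = (w k)%:E) ->
  measurable_fun setT H -> (forall x, 0 <= H x)%R ->
  (forall k x, (k < n)%N -> E k x ->
    \int[nu]_(t in J k) ((enorm (esub x (phi t)) `^ p)%R)%:E <=
    (w k * H x)%:E) ->
  wasserstein p mu (distribution nu phi) <= (\int[mu]_x (H x)%:E) `^ p^-1.
Proof.
move=> p1 mE mJ tE tJ w0 wn w1 muE nuJ mH H0 cost.
have sumE : \sum_(k < n) mu (E k) = 1.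
  by rewrite -w1 -sumEFin; apply: eq_bigr => k _; rewrite muE.
have sumJ : \sum_(k < n) nu (J k) = 1.
  by rewrite -w1 -sumEFin; apply: eq_bigr => k _; rewrite nuJ.
have mEJ k : measurable (E k `*` J k) by exact: measurableX.
have wV0 k : (0 <= (w k)^-1)%R by rewrite invr_ge0.
pose m_ k := mscale (NngNum (wV0 k)) (mrestr (mu \x nu) (mEJ k)).
pose m : {measure set (euclid R d * measurableTypeR R)%type -> \bar R} :=
  msum m_ n.
have m1 A B : measurable A -> measurable B -> m (A `*` B) =
    \sum_(k < n) (w k)^-1%:E * (mu (A `&` E k) * nu (B `&` J k)).
  move=> mA mB; apply: eq_bigr => k _.
  rewrite /m_ /= /mscale /= /mrestr -setXI.
  by rewrite [X in _ * X]product_measure1E//; exact: measurableI.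
have mT A : measurable A -> m (A `*` setT) = mu A.
  move=> mA; rewrite m1// -[RHS](sum_measure_partition mE tE sumE mA).
  apply: eq_bigr => k _; rewrite setTI nuJ// muleCA -EFinM mulVf ?mule1//.
  by rewrite gt_eqF// wn.
have mT' B : measurable B -> m (setT `*` B) = nu B.
  move=> mB; rewrite m1// -[RHS](sum_measure_partition mJ tJ sumJ mB).
  apply: eq_bigr => k _; rewrite setTI muE// muleA -EFinM mulVf ?mul1e//.
  by rewrite gt_eqF// wn.
have mTT : m setT = 1 by rewrite -setXTT mT// probability_setT.
have [P PE] := exists_probability mTT.
pose g (z : (euclid R d * measurableTypeR R)%type) := (z.1, phi z.2).
have mg : measurable_fun setT g.
  apply: measurable_fun_pair; first exact: measurable_fst.
  by apply: measurableT_comp => //; exact: measurable_snd.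
pose g_mfun : {mfun (euclid R d * measurableTypeR R)%type >->
    (euclid R d * euclid R d)%type} :=
  HB.pack g (isMeasurableFun.Build _ _ _ _ g mg).
pose xi : probability (euclid R d * euclid R d)%type R := distribution P g_mfun.
apply: (@le_trans _ _
    ((\int[xi]_z ((enorm (esub z.1 z.2) `^ p)%R)%:E) `^ p^-1)).
  apply: ereal_inf_lbound; exists xi => // A mA; split.
    rewrite -[RHS]mT// -PE -[LHS]/(P (g @^-1` (A `*` setT))).
    by congr (P _); apply/seteqP; split=> -[x t] /=.
  rewrite -[LHS]/(P (g @^-1` (setT `*` A))) -[RHS]/(nu (phi @^-1` A)).
  rewrite -[RHS]mT'; last exact: measurable_funPTI.
  by rewrite -PE; congr (P _); apply/seteqP; split=> -[x t] /=.
apply: gt0_ler_poweR; rewrite ?invr_ge0 ?in_itv /= ?leey ?andbT.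
- exact: le_trans p1.
- by apply: integral_ge0 => z _; rewrite lee_fin powR_ge0.
- by apply: integral_ge0 => z _; rewrite lee_fin.
pose c (z : (euclid R d * euclid R d)%type) : \bar R :=
  ((enorm (esub z.1 z.2) `^ p)%R)%:E.
have mc : measurable_fun setT c by exact: measurable_dist_powR.
have c0 z : 0 <= c z by rewrite lee_fin powR_ge0.
have mcg : measurable_fun setT (c \o g) by exact: measurableT_comp.
rewrite /xi /distribution (ge0_integral_pushforward (phi := g))//; last first.
  by move=> z _; exact: c0.
rewrite preimage_setT.
rewrite [leLHS](_ : _ = \int[m]_z (c \o g) z); last first.
  by apply: eq_measure_integral => A _ _; exact: PE.
rewrite /m ge0_integral_measure_sum//; last by move=> z _; exact: c0.
apply: (@le_trans _ _ (\sum_(k < n) \int[mu]_(x in E k) (H x)%:E)).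
  apply: lee_sum => k _; rewrite ge0_integral_mscale//= ge0_integral_mrestr//.
  rewrite lee_pdivrMl ?wn//.
  (* By Tonelli, the inner integral over [J k] is the one bounded in the hypothesis, and its factor
     [w k] cancels the normalization. *)
  pose f : (euclid R d * measurableTypeR R)%type -> \bar R :=
    (c \o g) \_ (E k `*` J k).
  have mf : measurable_fun setT f.
    by apply/(measurable_restrictT _ _).1 => //; exact: measurable_funTS.
  have f0 z : 0 <= f z by apply: erestrict_ge0 => y _; exact: c0.
  rewrite integral_mkcond -/f fubini_tonelli1//.
  rewrite -ge0_integralZl//; last 3 first.
  - exact/measurable_EFinP/measurable_funTS.
  - by move=> x _; rewrite lee_fin.
  - by rewrite lee_fin.
  rewrite [leRHS]integral_mkcond; apply: ge0_le_integral => //.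
  - by move=> x _; apply: integral_ge0 => t _; exact: f0.
  - exact: measurable_fun_fubini_tonelli_F.
  - apply/(measurable_restrictT _ _).1 => //.
    by apply/measurable_EFinP/measurable_funTS; apply: measurable_funM.
  - move=> x _; rewrite patchE; case: ifPn => [/set_mem Ekx|Ekx].
      rewrite [leLHS](_ : _ = \int[nu]_(t in J k) c (x, phi t)).
        exact: cost.
      rewrite [RHS]integral_mkcond; apply: eq_integral => t _.
      by rewrite /f !patchE in_setX/= mem_set.
    rewrite [leLHS](_ : _ = 0)//; apply: integral0_eq => t _.
    by rewrite /f patchE in_setX/= (negPf Ekx).
pose U := \big[setU/set0]_(0 <= k < n) E k.
have mU : measurable U by exact: bigsetU_measurable.
rewrite -(big_mkord xpredT (fun k => \int[mu]_(x in E k) (H x)%:E)).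
rewrite -(@ge0_integral_bigsetU _ _ _ mu _ E)//.
- by apply: ge0_subset_integral => //; [exact/measurable_EFinP|
    by move=> x _; rewrite lee_fin].
- exact: iota_uniq.
- by apply/trivIsetP => i j _ _ ij; move/trivIsetP: tE; apply.
- exact/measurable_EFinP/measurable_funTS.
- by move=> x _; rewrite lee_fin.
Qed.

(** * Quantization *)

Local Open Scope ring_scope.

(** A Lipschitz bound obtained from 1 - exp(-x) <= x with x = e ln r, and from ln r <= r - 1. *)
Lemma powR_sub1_le (R : realType) (e r : R) : 0 <= e -> 1 <= r <= 2 ->
  r `^ e - 1 <= e * 2 `^ e * (r - 1).
Proof.
move=> e0 /andP[r1 r2]; have r0 : 0 < r by lra.
have lnr : ln r <= r - 1.
  by have := @le_ln1Dx R (r - 1); rewrite (_ : 1 + (r - 1) = r); [apply; lra|ring].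
have rE : r `^ e = expR (e * ln r) by rewrite /powR gt_eqF.
have re2 : r `^ e <= 2 `^ e by rewrite ge0_ler_powR// ?nnegrE; lra.
have re0 : 0 < r `^ e by rewrite powR_gt0.
have h : r `^ e - 1 <= r `^ e * (e * ln r).
  have := expR_ge1Dx (- (e * ln r)); rewrite -(ler_pM2l re0).
  by rewrite [leRHS](_ : _ = 1); [lra|rewrite rE expRxMexpNx_1].
apply: le_trans h _; rewrite mulrCA -mulrA ler_wpM2l//.
by rewrite ler_pM ?ln_ge0// ltW.
Qed.

(** The preimage of j/m under the compression; for [j = 0] it would be infinite, and 0 is used
    instead. *)
Definition qpoint (R : realType) (del : R) (m j : nat) : R :=
  if j == 0%N then 0 else (j%:R / m%:R) `^ (- del^-1) - 1.

(* The compression a |-> (1 + a)^-del maps the half-line onto ]0, 1], which is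
   cut into m cells of equal length; the cells of both ends are sent to 0. *)
Definition qrank (R : realType) (del : R) (m : nat) (a : R) : nat :=
  let j := Num.truncn (m%:R * (1 + a) `^ (- del)) in if (j < m)%N then j else 0%N.

(** Cells have length 1/m after compression, and the inverse of the compression has derivative of
    order (1 + a)^(1 + del). *)
Lemma qpoint_error (R : realType) (del : R) (m : nat) (a : R) :
  0 < del -> (0 < m)%N -> 0 <= a ->
  `|a - qpoint del m (qrank del m a)| <=
    (1 + 2 * (del^-1 * 2 `^ del^-1)) * (m%:R^-1 * (1 + a) `^ (1 + del)).
Proof.
move=> del0 m0 a0; set C := del^-1 * _; set A := 1 + a.
have A1 : 1 <= A by rewrite lerDl.
have A0 : 0 < A by lra.
have e0 : 0 < del^-1 by rewrite invr_gt0.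
have C0 : 0 <= C by rewrite /C mulr_ge0 ?powR_ge0 ?ltW.
have hC r : 1 <= r <= 2 -> r `^ del^-1 - 1 <= C * (r - 1).
  exact/powR_sub1_le/ltW.
move: C C0 hC => C C0 hC.
have mR0 : 0 < m%:R :> R by rewrite ltr0n.
pose u : R := A `^ (- del).
have u0 : 0 < u by rewrite powR_gt0.
have uA : u * A `^ del = 1 by rewrite /u -powRD ?addNr ?powRr0// (gt_eqF A0) ?implybT.
have AdE : A `^ (1 + del) = A * A `^ del.
  by rewrite powRD ?powRr1 ?(ltW A0)// (gt_eqF A0) ?implybT.
have Ad0 : 0 < A `^ del by rewrite powR_gt0.
have err0 : 0 <= m%:R^-1 * A `^ (1 + del).
  by rewrite mulr_ge0 ?invr_ge0 ?powR_ge0 ?ler0n.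
have mu0 : 0 <= m%:R * u by rewrite mulr_ge0 ?ltW.
rewrite /qrank -/A -/u; set j := Num.truncn _.
have /andP[ju uj] := truncn_itv mu0; rewrite -/j in ju uj.
(* Here the compressed value is at least 1, so [a] is 0 and the point 0 is exact. *)
have [jm|mj] := ltnP j m; last first.
  rewrite /qpoint eqxx subr0 ger0_norm//.
  have u1 : 1 <= u.
    by rewrite -(ler_pM2l mR0) mulr1 (le_trans _ ju)// ler_nat.
  have a00 : a <= 0.
    rewrite leNgt; apply/negP => agt0.
    have : 1 `^ del < A `^ del by rewrite gt0_ltr_powR// ?nnegrE; rewrite /A; lra.
    by rewrite powR1; nra.
  by apply: le_trans a00 _; rewrite mulr_ge0//; lra.
(* In the lowest cell [m%:R * u] is below 1, that is (1 + a)^del > m, so the allowed error already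
   exceeds [a] itself. *)
rewrite /qpoint; case: eqP => [j0|/eqP j0].
  rewrite subr0 ger0_norm//.
  have mA : 1 <= m%:R^-1 * A `^ del.
    rewrite ler_pdivlMl// mulr1 -(ler_pM2l u0) uA mulrC.
    by rewrite j0 in uj; exact: ltW.
  rewrite AdE (mulrCA m%:R^-1); apply: (@le_trans _ _ (1 * (A * 1))); first by rewrite /A; lra.
  apply: ler_pM; rewrite ?mulr1//; [exact: ltW|lra|].
  by rewrite ler_peMr ?(ltW A0).
have jR0 : 0 < j%:R :> R by rewrite ltr0n lt0n.
pose v : R := j%:R / m%:R; have v0 : 0 < v by rewrite divr_gt0.
have vu : v <= u by rewrite ler_pdivrMr// mulrC.
have uv1 : u - v <= m%:R^-1.
  rewrite lerBlDr -(ler_pM2l mR0).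
  rewrite (_ : _ * (_ + v) = j%:R + 1); first by rewrite natr1 ltW.
  by rewrite /v; field; rewrite gt_eqF.
(* As [j] is at least 1, the ratio of [u] to its rounding [v] stays in [1, 2], where the Lipschitz
   bound applies. *)
have uv2 : u <= 2 * v.
  rewrite /v mulrA ler_pdivlMr// mulrC; apply: le_trans (ltW uj) _.
  by rewrite -natrM ler_nat mul2n -addnn -addn1 leq_add2l lt0n.
pose r := u / v.
have r1 : 1 <= r by rewrite ler_pdivlMr// mul1r.
have r2 : r <= 2 by rewrite ler_pdivrMr.
have bE : v `^ (- del^-1) = A * r `^ del^-1.
  rewrite /r powRM ?invr_ge0 ?(ltW u0) ?(ltW v0)//.
  rewrite /u -powRrM mulNr divff ?gt_eqF// powR_inv1 ?(ltW A0)// mulrA divff ?gt_eqF//.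
  by rewrite mul1r -(powR_inv1 (ltW v0)) -powRrM mulN1r.
have h := hC r (introT andP (conj r1 r2)).
have re1 : 1 <= r `^ del^-1.
  by have := @ler_powR R r r1 0 del^-1 (ltW e0); rewrite powRr0.
rewrite -/v bE [X in `|X|](_ : _ = - (A * (r `^ del^-1 - 1))); last first.
  by rewrite /A; ring.
rewrite normrN ger0_norm; last by rewrite mulr_ge0 ?subr_ge0// ltW.
have r1A : r - 1 <= 2 * (m%:R^-1 * A `^ del).
  have rv : r * v = u by rewrite divfK// gt_eqF.
  have : (r - 1) * u <= 2 * m%:R^-1.
    apply: (@le_trans _ _ ((r - 1) * (2 * v))); first by rewrite ler_wpM2l// subr_ge0.
    by rewrite mulrCA mulrBl rv mul1r ler_pM2l.
  rewrite -(ler_pM2r Ad0) -mulrA uA mulr1; lra.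
rewrite AdE; apply: (@le_trans _ _ (A * (C * (2 * (m%:R^-1 * A `^ del))))).
  rewrite ler_pM2l//; apply: le_trans h _; exact: ler_wpM2l.
rewrite AdE in err0; move: err0; set X := A `^ del; set M := m%:R^-1 => err0.
have -> : A * (C * (2 * (M * X))) = 2 * C * (M * (A * X)) by ring.
by rewrite ler_wpM2r//; lra.
Qed.

Lemma measurable_preimage_nat (d : measure_display) (T : measurableType d)
    (j : T -> nat) (P : set nat) :
  (forall n, measurable [set x | j x = n]) -> measurable (j @^-1` P).
Proof.
move=> mj; rewrite (_ : _ @^-1` _ = \bigcup_(n in P) [set x | j x = n]).
  by apply: bigcup_measurable => n _; exact: mj.
by apply/seteqP; split=> [x Px|x [n + /= jx]]; [exists (j x)|rewrite -jx].
Qed.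

Lemma measurable_qrank (R : realType) (del : R) (m : nat) (P : set nat) :
  measurable ([set x | P (qrank del m `|x|)] : set (measurableTypeR R)).
Proof.
pose w (x : measurableTypeR R) : R := m%:R * (1 + `|x|) `^ (- del).
have w0 x : 0 <= w x by rewrite mulr_ge0// powR_ge0.
have mw : measurable_fun setT w.
  apply: measurable_funM => //; apply: (measurableT_comp (measurable_powR _)).
  by apply: measurable_funD => //; exact: measurable_normr.
have := @measurable_preimage_nat _ _ (fun x => Num.truncn (w x))
  [set j | P (if (j < m)%N then j else 0%N)].
apply=> n; rewrite (_ : [set x | _] = w @^-1` `[n%:R, n.+1%:R[).
  by rewrite -[X in measurable X]setTI; apply: mw.
by apply/seteqP; split=> x /=; rewrite in_itv /= -truncn_eq// => /eqP.
Qed.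

(** The modulus is quantized, and the available values are shared between the two signs; the factor
    3 pays for this halving. A single available value is taken to be 0. *)
Lemma quantizer1 (R : realType) (del : R) : 0 < del ->
  exists C : R, 0 <= C /\ forall k : nat,
  exists (T : measurableTypeR R -> 'I_k.+1) (y : 'I_k.+1 -> R),
    (forall i, measurable [set x | T x = i]) /\
    forall x, `|(x : R) - y (T x)| <= C * (k.+1%:R^-1 * (1 + `|x|) `^ (1 + del)).
Proof.
move=> del0; set C := (1 + 2 * (del^-1 * 2 `^ del^-1)).
have C1 : 1 <= C by rewrite lerDl !mulr_ge0 ?powR_ge0 ?invr_ge0 ?ltW.
have qerr m a : (0 < m)%N -> 0 <= a ->
    `|a - qpoint del m (qrank del m a)| <= C * (m%:R^-1 * (1 + a) `^ (1 + del)).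
  exact: qpoint_error.
move: C C1 qerr => C C1 qerr.
exists (3 * C); split=> [|[|k]]; first lra.
  exists (fun=> ord0), (fun=> 0); split=> [i|x].
    have [->|i0] := eqVneq ord0 i; first by rewrite (_ : [set _ | _] = setT)//; apply/seteqP.
    rewrite (_ : [set _ | _] = set0)//; apply/seteqP; split=> // x /= e.
    by rewrite e eqxx in i0.
  rewrite subr0 invr1 mul1r.
  have x1 : `|x| <= (1 + `|x|) `^ (1 + del).
    apply: (@le_trans _ _ (1 + `|x|)); first lra.
    by apply: le1r_powR; [rewrite lerDl|lra].
  by apply: le_trans x1 _; rewrite ler_peMl ?powR_ge0//; lra.
pose m := (k.+2)./2; have m0 : (0 < m)%N by [].
have mk : (m.*2 <= k.+2)%N by rewrite -[leqRHS]odd_double_half leq_addl.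
have km : k.+2%:R <= 3 * m%:R :> R.
  rewrite -natrM ler_nat mulnC !mulnS muln0 addn0 -/(addn _ _).
  by have := odd_double_half k.+2; rewrite -/m -addnn; have := leq_b1 (odd k.+2); lia.
have rm x : (qrank del m `|x : R| < m)%N by rewrite /qrank; case: ifP.
pose c (s : bool) (n : nat) := ((if s then 0 else m) + n)%N.
have ck s n : (n < m)%N -> (c s n < k.+2)%N by rewrite /c; case: s; lia.
pose T (x : measurableTypeR R) : 'I_k.+2 :=
  inord (c (0 <= (x : R)) (qrank del m `|x : R|)).
pose y (i : 'I_k.+2) : R :=
  if (i < m)%N then qpoint del m i else - qpoint del m (i - m)%N.
have Tv x : T x = c (0 <= (x : R)) (qrank del m `|x : R|) :> nat.
  by rewrite inordK// ck.
exists T, y; split=> [i|x].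
  rewrite (_ : [set x | _] =
    (`[0%R, +oo[ `&` [set x | [set n | n = i :> nat] (qrank del m `|x|)]) `|`
    (`]-oo, 0%R[ `&` [set x | [set n | (m + n)%N = i :> nat] (qrank del m `|x|)])).
    by apply: measurableU; apply: measurableI => //; exact: measurable_qrank.
  apply/seteqP; split=> x /=; rewrite !in_itv /= andbT.
    move=> /(congr1 val) /=; rewrite Tv /c.
    by have [x0|x0] := leP 0 (x : R) => /= <-; [left|right].
  move=> xi; apply: val_inj; rewrite /= Tv /c; case: xi => [[-> <-]//|[]].
  by rewrite ltNge => /negbTE -> <-.
have yE : `|(x : R) - y (T x)| = `| `|x : R| - qpoint del m (qrank del m `|x : R|)|.
  rewrite /y Tv /c; have [x0|x0] := leP 0 (x : R).
    by rewrite add0n rm (ger0_norm x0).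
  rewrite ltnNge leq_addr /= addKn (ltr0_norm x0) -[RHS]normrN; congr `|_|; ring.
rewrite yE; apply: le_trans (qerr m _ m0 (normr_ge0 _)) _.
rewrite mulrA [leRHS]mulrA ler_wpM2r ?powR_ge0//.
rewrite [leRHS](_ : _ = C * (3 / k.+2%:R)); last by rewrite mulrCA mulrA.
rewrite ler_wpM2l//; first lra.
by rewrite ler_pdivlMr ?ltr0n// mulrC ler_pdivrMr ?ltr0n.
Qed.

Lemma le_coord_enorm (R : realType) (d : nat) (x : euclid R d) (i : 'I_d) :
  `|tnth x i : R| <= enorm x.
Proof.
rewrite -sqrtr_sqr ler_sqrt ?sumr_ge0// => [|j _]; last exact: sqr_ge0.
by rewrite (bigD1 i)//= lerDl sumr_ge0// => j _; exact: sqr_ge0.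
Qed.

Lemma enorm_le_sum (R : realType) (d : nat) (x : euclid R d) :
  enorm x <= \sum_(i < d) `|tnth x i : R|.
Proof.
have S0 (s : seq 'I_d) : 0 <= \sum_(i <- s) `|tnth x i : R| by rewrite sumr_ge0.
rewrite -[leRHS]ger0_norm ?S0// -sqrtr_sqr ler_sqrt ?sqr_ge0//.
elim: (index_enum _) => [|i s IH]; first by rewrite !big_nil expr0n.
rewrite !big_cons sqrrD -[X in X + _ + _]normrX [X in X + _ + _]ger0_norm ?sqr_ge0//.
have := mulr_ge0 (normr_ge0 (tnth x i : R)) (S0 s); lra.
Qed.

Lemma quantizer (R : realType) (d : nat) (del : R) : 0 < del ->
  exists C : R, 0 <= C /\ forall k : nat,
  exists (T : euclid R d -> {ffun 'I_d -> 'I_k.+1})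
      (y : {ffun 'I_d -> 'I_k.+1} -> 'I_d -> R),
    (forall f, measurable [set x | T x = f]) /\
    forall x i, `|(tnth x i : R) - y (T x) i| <=
      C * (k.+1%:R^-1 * (1 + enorm x) `^ (1 + del)).
Proof.
move=> del0; have [C [C0 CE]] := quantizer1 del0.
exists C; split=> // k; have [T [y [mT yE]]] := CE k.
exists (fun x => [ffun i => T (tnth x i)]), (fun f i => y (f i)).
split=> [f|x i].
  rewrite (_ : [set x | _] =
    \big[setI/setT]_(i < d) ((@tnth _ _)^~ i @^-1` [set t | T t = f i])).
    apply: bigsetI_measurable => i _; rewrite -[X in measurable X]setTI.
    by apply: measurable_tnth => //; exact: mT.
  rewrite -bigcap_seq; apply/seteqP; split=> x /= => [<- i _|Tx].
    by rewrite ?ffunE.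
  by apply/ffunP => i; rewrite ffunE; apply: Tx; rewrite /= mem_index_enum.
rewrite ffunE; apply: le_trans (yE _) _.
have h0 : 0 <= `|tnth x i : R| by [].
have h1 := le_coord_enorm x i.
by rewrite ler_wpM2l// ler_wpM2l ?invr_ge0// ge0_ler_powR ?nnegrE//; lra.
Qed.

(** * Approximation by networks *)

Local Open Scope ereal_scope.

Lemma integral_le_two_values (d : measure_display) (T : measurableType d)
    (R : realType) (m : {measure set T -> \bar R}) (D G : set T)
    (f : T -> \bar R) (a b : R) :
  measurable D -> measurable G -> measurable_fun D f -> (forall x, 0 <= f x) ->
  (0 <= a)%R -> (0 <= b)%R ->
  (forall x, D x -> G x -> f x <= a%:E) -> (forall x, D x -> f x <= b%:E) ->
  \int[m]_(x in D) f x <= a%:E * m D + b%:E * m (D `\` G).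
Proof.
move=> mD mG mf f0 a0 b0 fa fb.
have mDG : measurable (D `&` G) by exact: measurableI.
have mDG' : measurable (D `\` G) by exact: measurableD.
have mf1 : measurable_fun (D `&` G) f by apply: measurable_funS mf => // x [].
have mf2 : measurable_fun (D `\` G) f by apply: measurable_funS mf => // x [].
rewrite -[in leLHS](setUIDK D G) ge0_integral_setU//; last 2 first.
- by rewrite setUIDK.
- by apply/disj_setPS => x [[_ Gx] [_ /(_ Gx)]].
apply: leeD.
  apply: (@le_trans _ _ (\int[m]_(x in D `&` G) (cst a%:E) x)).
    by apply: ge0_le_integral => //= x [Dx Gx]; exact: fa.
  by rewrite integral_cst// lee_wpmul2l ?lee_fin// le_measure ?inE// => x [].
apply: (@le_trans _ _ (\int[m]_(x in D `\` G) (cst b%:E) x)).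
  by apply: ge0_le_integral => //= x [Dx Gx]; exact: fb.
by rewrite integral_cst.
Qed.

Lemma enorm_esub_le (R : realType) (d : nat) (x y : euclid R d) (c : R) :
  (forall i, `|(tnth x i : R) - tnth y i| <= c)%R ->
  (enorm (esub x y) <= d%:R * c)%R.
Proof.
move=> xyc; apply: le_trans (enorm_le_sum _) _.
rewrite -[X in (X%:R * c)%R]card_ord mulr_natl -sumr_const; apply: ler_sum => i _.
by rewrite tnth_mktuple.
Qed.

Lemma powR1D_le (R : realType) (q a : R) : (0 <= q)%R -> (0 <= a)%R ->
  ((1 + a) `^ q <= 2 `^ q * (1 + a `^ q))%R.
Proof.
move=> q0 a0; have [a1|a1] := leP a 1%R.
  apply: (@le_trans _ _ (2 `^ q)%R).
    by rewrite ge0_ler_powR ?nnegrE//; lra.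
  by rewrite ler_peMr ?powR_ge0// lerDl powR_ge0.
apply: (@le_trans _ _ ((2 * a) `^ q)%R).
  by rewrite ge0_ler_powR ?nnegrE//; lra.
by rewrite powRM// ler_wpM2l ?powR_ge0// lerDr.
Qed.

Lemma probability_fiber_sum (d : measure_display) (T : measurableType d)
    (R : realType) (m : probability T R) (F : finType) (g : T -> F) :
  (forall f, measurable [set x | g x = f]) ->
  \sum_(f : F) m [set x | g x = f] = 1.
Proof.
move=> mg; rewrite (reindex (@enum_val F predT)) /=; last first.
  exact/onW_bij/enum_val_bij.
rewrite -(measure_bigsetU_ord m xpredT (F := fun i => [set x | g x = enum_val i])).
- rewrite -bigcup_seq -[RHS](probability_setT m); congr (m _).
  apply/seteqP; split=> // x _; exists (enum_rank (g x)) => /=.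
    by rewrite mem_index_enum.
  by rewrite enum_rankK.
- by move=> i; exact: mg.
- apply/trivIsetP => i j _ _ ij; apply/seteqP; split=> // x [] /= ->.
  by move=> /enum_val_inj /eqP; rewrite (negPf ij).
Qed.

(** With [del = q / p - 1], the p-th power of the quantization error is of order (k + 1)^(-p) (1 +
    |x|)^q. The network is built for the quantization points first, and the mass allowed off the
    plateaus is chosen last. *)
Lemma wasserstein_NN_le (R : realType) (d : nat) (p q : R) :
  (1 <= p)%R -> (p < q)%R ->
  exists K : R, (0 <= K)%R /\
  forall (nu : probability (measurableTypeR R) R) (mu : probability (euclid R d) R)
    (W L n m b k : nat),
  nu `<< lebesgue_measure -> (0 < b)%N ->
  (2 * d.+1 + 4 * m <= W)%N -> (2 * d.+1 + 4 * d * b <= W)%N ->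
  (n.*2 <= L)%N -> (k.+1 ^ d <= n * m * b)%N ->
  wasserstein_NN p mu W L nu <=
  (\int[mu]_x ((K * k.+1%:R^-1 `^ p * (1 + enorm x `^ q))%R)%:E) `^ p^-1.
Proof.
move=> p1 pq.
have p0 : (0 < p)%R by lra.
have q0 : (0 < q)%R by lra.
have del0 : (0 < q / p - 1)%R by rewrite subr_gt0 ltr_pdivlMr ?mul1r.
have [C [C0 CE]] := quantizer d del0.
pose K := (2 `^ q * ((d%:R * C) `^ p + 1))%R.
have K0 : (0 <= K)%R by rewrite mulr_ge0 ?addr_ge0 ?powR_ge0.
exists K; split=> // nu mu W L n m b k nul b0 mW bW nL kN.
have [T [y [mT yE]]] := CE k.
pose F : finType := {ffun 'I_d -> 'I_k.+1}.
pose f0 : F := [ffun=> ord0].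
(* Null cells are discarded, since the tiling of the line needs positive masses; their union is the
   set [E (size s)]. *)
pose s := [seq f <- enum F | mu [set x | T x = f] != 0].
have uniqs : uniq s by rewrite filter_uniq// enum_uniq.
have sizes : (size s <= n * m * b)%N.
  apply: leq_trans kN; rewrite size_filter; apply: leq_trans (count_size _ _) _.
  by rewrite -cardE card_ffun !card_ord.
pose E j := [set x | index (T x) s = j].
have EE j : (j < size s)%N -> E j = [set x | T x = nth f0 s j].
  move=> js; apply/seteqP; split=> x; rewrite /E /= => xj.
    by rewrite -xj nth_index// -index_mem xj.
  by rewrite xj index_uniq.
have mE j : measurable (E j).
  rewrite (_ : E j = \bigcup_(f in [set f | index f s = j]) [set x | T x = f]).
    by apply: fin_bigcup_measurable => //; exact: finite_finset.
  apply/seteqP; split=> x.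
    by move=> xj; exists (T x); rewrite /mkset.
  by move=> [f fj xf]; rewrite /E /= xf; exact: fj.
have tE : trivIset setT E.
  apply/trivIsetP => i j _ _ ij; apply/seteqP; split=> // x [xi xj].
  by case/eqP: ij; rewrite -[LHS]xi; exact: xj.
have sumE : \sum_(j < size s) mu (E j) = 1.
  rewrite -(big_mkord xpredT (fun j => mu (E j))).
  rewrite (eq_big_nat _ _ (F2 := fun j => mu [set x | T x = nth f0 s j])); last first.
    by move=> j /andP[_ js]; rewrite EE.
  rewrite -(big_nth f0 xpredT (fun f => mu [set x | T x = f])) big_filter.
  rewrite big_enum_cond /= -(probability_fiber_sum mu mT) [LHS]big_mkcond.
  by apply: eq_bigr => f _; case: eqP.
pose w j := fine (mu (E j)).
have wE j : mu (E j) = (w j)%:E by rewrite fineK// fin_num_measure.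
have w0 j : (0 <= w j)%R by rewrite fine_ge0.
have ws j : (j < size s)%N -> (0 < w j)%R.
  move=> js; rewrite lt_neqAle w0 andbT -eqe -wE EE// eq_sym.
  by have := mem_nth f0 js; rewrite mem_filter => /andP[].
have w1 : (\sum_(j < size s) w j = 1)%R.
  apply: EFin_inj; rewrite -sumEFin -sumE; exact: eq_bigr.
have s0 : (0 < size s)%N.
  by rewrite lt0n; apply/eqP => s0; move: w1; rewrite s0 big_ord0 => /esym/eqP; rewrite oner_eq0.
have [M0 netE] := plateau_net (fun j => y (nth f0 s j)) b0 mW bW nL.
pose M := `|M0|%R; have M00 : (0 <= M)%R by exact: normr_ge0.
pose bd := ((d%:R * (1 + M)) `^ p)%R.
have bd0 : (0 <= bd)%R by exact: powR_ge0.
have kp0 : (0 < k.+1%:R^-1 `^ p :> R)%R by rewrite powR_gt0 ?invr_gt0.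
(* A fraction [e] of mass at the off-plateau cost [bd] must not exceed the order of the quantization
   error. *)
have [e [e0 e1 ebd]] : exists e : R, [/\ 0 < e, e <= 1 & e * bd <= k.+1%:R^-1 `^ p]%R.
  exists (Num.min 1 (k.+1%:R^-1 `^ p / (bd + 1)))%R; split.
  - by rewrite lt_min ltr01 divr_gt0//; lra.
  - by rewrite ge_min lexx.
  - apply: (@le_trans _ _ (k.+1%:R^-1 `^ p / (bd + 1) * bd))%R.
      by rewrite ler_wpM2r// ge_min lexx orbT.
    by rewrite mulrAC ler_pdivrMr ?ler_pM2l//; lra.
have [A [B [J [[AB BA] mJ tJ nuJ nuJAB]]]] :=
  cdfr_tiling nul s0 w0 ws w1 (introT andP (conj e0 e1)).
have [f [fW fL fE fM]] := netE A B AB BA.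
pose phi : {mfun measurableTypeR R >-> euclid R d} :=
  HB.pack (net_fun f) (isMeasurableFun.Build _ _ _ _ _ (measurable_net_fun f)).
apply: (@le_trans _ _ (wasserstein p mu (distribution nu phi))).
  by apply: ereal_inf_lbound; exists phi => //; exists f; split.
apply: (wasserstein_tiling (w := w) (n := size s) p1 mE mJ tE tJ) => //.
- apply: measurable_funM => //; apply: measurable_funD => //.
  by apply: (measurableT_comp (measurable_powR q)); exact: measurable_enorm.
- by move=> x; rewrite !mulr_ge0 ?addr_ge0 ?powR_ge0// ltW.
move=> j x js Ejx.
have jN := leq_trans js sizes.
pose a := ((d%:R * (C * (k.+1%:R^-1 * (1 + enorm x) `^ (q / p)))) `^ p)%R.
have x0 : (0 <= enorm x)%R by rewrite sqrtr_ge0.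
have aE : a = ((d%:R * C) `^ p * k.+1%:R^-1 `^ p * (1 + enorm x) `^ q)%R.
  rewrite /a !mulrA powRM ?powR_ge0//; last by rewrite !mulr_ge0.
  by rewrite powRM ?mulr_ge0// -powRrM divfK ?gt_eqF.
pose c := (bd * (1 + enorm x) `^ q)%R.
have cE : nu (J j `\` `[A j, B j]%classic) <= (e * w j)%:E by exact: nuJAB.
apply: (@le_trans _ _ (a%:E * nu (J j) + c%:E * nu (J j `\` `[A j, B j]%classic))).
  apply: integral_le_two_values => //.
  - apply: measurable_funTS.
    have mxphi : measurable_fun setT (fun t => (x, phi t)).
      by apply: measurable_fun_pair; [exact: measurable_cst|exact: measurable_funP].
    exact: (measurableT_comp (@measurable_dist_powR R d p) mxphi).
  - by move=> t; rewrite lee_fin powR_ge0.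
  - exact: powR_ge0.
  - by rewrite mulr_ge0 ?powR_ge0.
  - move=> t Jt tAB; rewrite lee_fin ge0_ler_powR ?nnegrE ?sqrtr_ge0 ?(ltW p0)//.
      by rewrite !mulr_ge0 ?powR_ge0 ?ler0n.
    apply: enorm_esub_le => i; rewrite (fE j)//.
    have Txj : T x = nth f0 s j by move: Ejx; rewrite EE.
    have -> : (q / p = 1 + (q / p - 1))%R by ring.
    by rewrite -Txj; exact: yE.
  (* Everywhere on [J j] a coordinate of the difference is at most |x| + M <= (1 + M)(1 + |x|); the
     exponent [p] of 1 + |x| >= 1 is then raised to [q]. *)
  - move=> t Jt; rewrite lee_fin.
    apply: (@le_trans _ _ ((d%:R * (1 + M) * (1 + enorm x)) `^ p)%R).
      rewrite ge0_ler_powR ?nnegrE ?sqrtr_ge0 ?(ltW p0)//.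
        by rewrite !mulr_ge0// addr_ge0.
      rewrite -mulrA; apply: enorm_esub_le => i.
      apply: le_trans (ler_normB _ _) _.
      have := le_coord_enorm x i; have := fM t i; have := ler_norm M0.
      rewrite -/M => h1 h2 h3.
      have := mulr_ge0 M00 x0; lra.
    rewrite powRM ?mulr_ge0 ?addr_ge0// ler_wpM2l//.
    by apply: ler_powR; [rewrite lerDl|exact: ltW].
rewrite nuJ//; apply: (@le_trans _ _ (a%:E * (w j)%:E + c%:E * (e * w j)%:E)).
  by rewrite leeD2l// lee_wpmul2l// lee_fin mulr_ge0 ?powR_ge0.
rewrite -!EFinM -EFinD lee_fin aE /c.
have := powR1D_le (ltW q0) x0; set X := ((1 + _) `^ q)%R; set Y := (1 + _)%R => XY.
have X0 : (0 <= X)%R by exact: powR_ge0.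
have : (X * (((d%:R * C) `^ p) * k.+1%:R^-1 `^ p + e * bd) <=
  2 `^ q * Y * ((d%:R * C) `^ p + 1) * k.+1%:R^-1 `^ p)%R.
  rewrite -[leRHS]mulrA ler_pM//.
    by rewrite addr_ge0 ?mulr_ge0 ?powR_ge0// ltW.
  by rewrite mulrDl mul1r lerD2l.
move=> /(ler_wpM2l (w0 j)); rewrite /K; lra.
Qed.

Lemma expn_bracket (d P : nat) : (0 < d)%N -> (0 < P)%N ->
  exists k : nat, (k.+1 ^ d <= P < k.+2 ^ d)%N.
Proof.
move=> d0 P0.
have ex : exists k, (k.+1 ^ d <= P)%N by exists 0%N; rewrite exp1n.
have bd k : (k.+1 ^ d <= P)%N -> (k <= P)%N.
  by apply: leq_trans; apply: leq_trans (leqnSn k) _; exact: (leq_pexp2l _ d0).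
have [k kP kmax] := ex_maxnP ex bd; exists k; rewrite kP /= ltnNge.
by apply/negP => /kmax; rewrite ltnn.
Qed.

(** Beyond the carriers a width [w] remains, with [4 * d <= w] and [W <= 2 * w] by the lower bound
    on [W]. Rounding down costs factors 8, 8d and 4 at most, whence 16 * 16d * 4 = 1024d. *)
Lemma layer_sizes (d : nat) : (0 < d)%N ->
  exists c : nat, forall W L : nat, (7 * d + 1 <= W)%N -> (2 <= L)%N ->
  exists n m b : nat,
  [/\ (2 * d.+1 + 4 * m <= W)%N /\ (2 * d.+1 + 4 * d * b <= W)%N, (n.*2 <= L)%N,
      (0 < b)%N, (0 < n * m * b)%N & (W ^ 2 * L <= c * (n * m * b))%N].
Proof.
move=> d0; exists (1024 * d)%N => W L dW L2; pose w := (W - 2 * d.+1)%N.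
exists L./2, (w %/ 4)%N, (w %/ (4 * d))%N.
have w4d : (4 * d <= w)%N by rewrite /w; lia.
have d40 : (0 < 4 * d)%N by rewrite muln_gt0.
have Ww : (W <= 2 * w)%N by rewrite /w; lia.
have wW : (2 * d.+1 + w <= W)%N by rewrite /w; lia.
have m0 : (0 < w %/ 4)%N by rewrite divn_gt0//; lia.
have b0 : (0 < w %/ (4 * d))%N by rewrite divn_gt0.
have n0 : (0 < L./2)%N by rewrite half_gt0.
have m1 := leq_trunc_div w 4; have b1 := leq_trunc_div w (4 * d).
have m2 : (w <= 8 * (w %/ 4))%N by have := ltn_ceil w (isT : (0 < 4)%N); lia.
have b2 : (w <= 8 * d * (w %/ (4 * d)))%N.
  have := ltn_ceil w d40; move: (w %/ (4 * d))%N b0 => b b0.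
  move=> /ltnW /leq_trans; apply; apply: (@leq_trans (2 * b * (4 * d))).
    by rewrite leq_mul2r; apply/orP; right; lia.
  by apply: eq_leq; lia.
have n2 : (L <= 4 * L./2)%N by have := odd_double_half L; have := leq_b1 (odd L); lia.
split=> //.
- by split; apply: leq_trans wW; rewrite leq_add2l mulnC.
- by rewrite -[leqRHS]odd_double_half leq_addl.
- by rewrite !muln_gt0 m0 b0 n0.
- apply: (@leq_trans ((2 * (8 * (w %/ 4))) * (2 * (8 * d * (w %/ (4 * d)))) * (4 * L./2))).
    rewrite expnS expn1 leq_mul// leq_mul//.
      by apply: leq_trans Ww _; rewrite leq_mul2l.
    by apply: leq_trans Ww _; rewrite leq_mul2l.
  by apply: eq_leq; lia.
Qed.

Lemma rate_ge (R : realType) (d : nat) (p q : R) (W L : nat) :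
  (2 <= W ^ 2 * L)%N ->
  ((W ^ 2 * L)%:R `^ (- d%:R^-1) <= rate d p q W L)%R.
Proof.
move=> N2; rewrite /rate; case: ifP => _ //; rewrite ler_peMr ?powR_ge0//.
have l2 : (0 < ln 2 :> R)%R by rewrite ln_gt0// ltr1n.
have : (1 <= log2 ((W ^ 2 * L)%:R : R))%R.
  by rewrite /log2 ler_pdivlMr// mul1r ler_ln ?posrE ?ltr0n ?ler_nat//; lia.
have d0 : (0 <= d%:R^-1 :> R)%R by rewrite invr_ge0.
move=> l1; have := ge0_ler_powR d0 _ _ l1; rewrite powR1; apply; rewrite nnegrE//.
exact: le_trans l1.
Qed.

(** Since [k.+2 <= 2 * k.+1], the hypotheses give N <= c (2(k + 1))^d; then take d-th roots. *)
Lemma rate_scale (R : realType) (c d P N k : nat) : (0 < d)%N -> (0 < N)%N ->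
  (N <= c * P)%N -> (P < k.+2 ^ d)%N ->
  (k.+1%:R^-1 <= 2 * c%:R `^ d%:R^-1 * N%:R `^ (- d%:R^-1) :> R)%R.
Proof.
move=> d0 N0 NP Pk.
have Nk : (N <= c * (2 * k.+1) ^ d)%N.
  apply: leq_trans NP _; rewrite leq_mul2l; apply/orP; right.
  by apply: leq_trans (ltnW Pk) _; rewrite leq_exp2r//; lia.
have : (N%:R `^ d%:R^-1 <= (c%:R * (2 * k.+1%:R) ^+ d) `^ d%:R^-1 :> R)%R.
  rewrite ge0_ler_powR ?nnegrE ?invr_ge0//.
  by rewrite -(natrM _ 2) -natrX -natrM ler_nat.
rewrite powRM// -powR_mulrn// -powRrM divff ?pnatr_eq0 -?lt0n// powRr1// => h.
have N1 : (0 < N%:R `^ d%:R^-1 :> R)%R by rewrite powR_gt0// ltr0n.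
rewrite powRN ler_pdivlMr// mulrC ler_pdivrMr ?ltr0n//.
by apply: le_trans h _; rewrite mulrCA mulrA.
Qed.

Theorem theorem2p1 (R : realType) (d : nat) (p q : R)
    (d_gt0 : (0 < d)%N) (p_ge1 : (1 <= p)%R) (ltpq : (p < q)%R) :
  exists C : R,
    forall (nu : probability (measurableTypeR R) R)
           (mu : probability (euclid R d) R),
      nu `<< lebesgue_measure -> moment q mu < +oo ->
      forall W L : nat, (7 * d + 1 <= W)%N -> (2 <= L)%N ->
        wasserstein_NN p mu W L nu <=
          C%:E * (moment q mu `^ q + 1) `^ (p^-1)%R * (rate d p q W L)%:E.
Proof.
have [K [K0 KE]] := wasserstein_NN_le d p_ge1 ltpq.
have q0 : (0 < q)%R by lra.
have p0 : (0 < p)%R by lra.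
have [c cE] := layer_sizes d_gt0.
(* The first factor comes from the cost of the coupling, the second from converting 1/(k + 1) into a
   power of W^2 L. *)
exists (K `^ p^-1 * (2 * c%:R `^ d%:R^-1))%R => nu mu nul _ W L dW L2.
have [n [m [b [[mW bW] nL b0 P0 NP]]]] := cE W L dW L2.
have [k /andP[kP Pk]] := expn_bracket d_gt0 P0.
have N2 : (2 <= W ^ 2 * L)%N.
  by apply: leq_trans L2 _; rewrite leq_pmull// expn_gt0; apply/orP; left; lia.
apply: le_trans (KE nu mu W L _ _ _ k nul b0 mW bW nL kP) _.
set I := \int[mu]_x ((enorm x `^ q)%R)%:E.
have I0 : 0 <= I by apply: integral_ge0 => x _; rewrite lee_fin powR_ge0.
have -> : moment q mu `^ q = I by rewrite /moment -poweRrM mulVf ?gt_eqF// poweRe1.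
have c0 : (0 <= K * k.+1%:R^-1 `^ p)%R by rewrite mulr_ge0 ?powR_ge0.
have mq : measurable_fun setT (fun x : euclid R d => ((enorm x `^ q)%R)%:E).
  apply/measurable_EFinP; apply: (measurableT_comp (measurable_powR q)).
  exact: measurable_enorm.
have -> : \int[mu]_x ((K * k.+1%:R^-1 `^ p * (1 + enorm x `^ q))%R)%:E =
    (K * k.+1%:R^-1 `^ p)%:E * (I + 1).
  under eq_integral do rewrite EFinM EFinD.
  rewrite ge0_integralZl//; last 2 first.
  - by apply: emeasurable_funD => //; exact: measurable_cst.
  - by move=> x _; rewrite -EFinD lee_fin addr_ge0 ?powR_ge0.
  rewrite ge0_integralD//; last by move=> x _; rewrite lee_fin powR_ge0.
  rewrite addeC -/I (_ : \int[mu]__ _ = 1)//.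
  rewrite -[LHS]/(\int[mu]_(x in setT) (cst 1%:E) x) integral_cst// mul1e.
  exact: probability_setT.
have I1 : 0 <= I + 1 := adde_ge0 I0 lee01.
rewrite poweRM ?lee_fin// poweR_EFin muleAC -EFinM.
rewrite lee_wpmul2r ?poweR_ge0// lee_fin powRM ?powR_ge0//.
rewrite -powRrM divff ?gt_eqF// powRr1// -!mulrA ler_wpM2l ?powR_ge0//.
apply: le_trans (rate_scale R d_gt0 (ltnW N2) NP Pk) _; rewrite -mulrA.
by rewrite ler_wpM2l// ler_wpM2l ?powR_ge0// rate_ge.
Qed.
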